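(* Let $f(z)=\sum_{n=0}^\infty a_nz^n$ and $g(z)=\sum_{n=0}^\infty b_nz^n$ be two analytic functions defined in $\mathbb{D}$, and let $r_0:=1-\sqrt{2/3}$. Then for all $r=|z|\leq r_0$: (i) if $g\prec f$, then $\mathcal{M}_{g'}(r)\leq \mathcal{M}_{f'}(r)$; (ii) if $|g(z)|\leq|f(z)|$ for all $z\in\mathbb{D}$, and $f(0)=0$, then $\mathcal{M}_{g'}(r)\leq \mathcal{M}_{f'}(r)$. The radius $r_0$ cannot be improved in either case: for each of (i) and (ii) and for every $r\in(r_0,1)$ there are analytic functions $f,g$ in $\mathbb{D}$ satisfying the hypothesis of that part with $\mathcal{M}_{g'}(r)>\mathcal{M}_{f'}(r)$.
   Context: $\mathbb{D}$ denotes the open unit disk in $\mathbb{C}$. For a complex valued analytic function $F(z)=\sum_{n=0}^\infty A_nz^n$ in $\mathbb{D}$, its majorant series is $\mathcal{M}_F(r):=\sum_{n=0}^\infty |A_n|r^n$ for $0\le r<1$. For analytic functions $f,g$ in $\mathbb{D}$, $g\prec f$ ($g$ is subordinate to $f$) means that there is a function $\phi$ analytic in $\mathbb{D}$ with $\phi(0)=0$ and $|\phi(z)|<1$ for $z\in\mathbb{D}$ such that $g=f\circ\phi$. *)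

(* Defs.v *)
(* Stdlib world: the classical reals, with Coquelicot's complex numbers [C]. *)
From Stdlib Require Import Reals ClassicalEpsilon.
From Coquelicot Require Export Coquelicot.

Local Open Scope R_scope.

Definition in_disk (z : C) : Prop := Cmod z < 1.

Definition analytic_at (F : C -> C) (z0 : C) : Prop :=
  exists (A : nat -> C) (rho : R), 0 < rho /\
    forall z : C, Cmod (z - z0)%C < rho -> is_pseries A (z - z0)%C (F z).

(* Functions on the disk are total functions on [C]; their values outside the
   disk play no role. *)
Definition analytic_on_disk (F : C -> C) : Prop :=
  forall z0 : C, in_disk z0 -> analytic_at F z0.

Definition has_expansion (F : C -> C) (A : nat -> C) : Prop :=
  forall z : C, in_disk z -> is_pseries A z (F z).

(* The sequence [A] with [F z = sum A_n z^n] in the disk. It exists and is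
   unique when [F] is analytic in the disk, and is arbitrary otherwise. *)
Definition coeffs (F : C -> C) : nat -> C :=
  epsilon (inhabits (fun _ : nat => RtoC 0)) (has_expansion F).

(* For [F] analytic in the disk and [0 <= r < 1] the series converges, so that
   [Series] is its sum. *)
Definition majorant_series (F : C -> C) (r : R) : R :=
  Series (fun n : nat => Cmod (coeffs F n) * r ^ n).

Definition subordinate (g f : C -> C) : Prop :=
  exists phi : C -> C,
    analytic_on_disk phi /\
    phi (RtoC 0) = RtoC 0 /\
    (forall z : C, in_disk z -> Cmod (phi z) < 1) /\
    (forall z : C, in_disk z -> g z = f (phi z)).

Definition dominated (g f : C -> C) : Prop :=
  f (RtoC 0) = RtoC 0 /\
  forall z : C, in_disk z -> Cmod (g z) <= Cmod (f z).

Definition r0 : R := 1 - sqrt (2 / 3).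

(* Main.v *)
Require Import Defs.
From Stdlib Require Import Reals Arith Lra Lia ClassicalEpsilon.
From Coquelicot Require Import Coquelicot.
Local Open Scope R_scope.

(** Let [a_n] be the coefficients of [f].  A function [g] as in either part
    satisfies [g - g 0 = sum_(n >= 1) a_n u_n] near [0], with [u_n = phi^n] when [g = f o phi], and [u_n = z^n h] when [g = f h].  In both
    cases [u_n] is bounded by [1] in the disk and vanishes to the order [n] at
    [0].  The triangle inequality therefore reduces everything to the majorant
    series of a single [u_n'], which has to be at most [n r^(n-1)]
    ([majorant_principle]).

    Write [u_n = z^n (c_0 + c_1 z + ...)].  The series in parentheses is a
    function bounded by [1], so [|c_j| <= 2 (1 - |c_0|)] for [j >= 1]
    ([bounded_coeff]); this is Carathéodory's inequality for functions with
    nonnegative real part ([Caratheodory_coeff]).  Hence the majorant of [u_n']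
    is at most [r^(n-1)] times
    [n |c_0| + 2 (1 - |c_0|) sum_(j >= 1) (n + j) r^j], and since
    [n + j <= n (1 + j)], that is at most
    [n (|c_0| + 2 (1 - |c_0|) (1 / (1 - r)^2 - 1))].  The radius [r0] is where
    [1 / (1 - r)^2 - 1 = 1 / 2], so for [r <= r0] the bound is [n]
    ([derivative_sum_le]).

    The number [r0] is the best possible because the estimates are
    asymptotically sharp for [f z = z] and [g z = z (a - z) / (1 - a z)] as [a]
    tends to [1]: the majorant of [g'] at [r] is
    [a + (1 - a^2) r (2 - a r) / (1 - a r)^2], and for [r > r0] it exceeds [1]
    for [a] close to [1].  The same pair serves both parts, since [g] is both
    subordinate to [f] and dominated by it.

    Analyticity is local, so most of the work is the classical theory that
    makes these arguments global.  Holomorphic means here continuously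
    complex-differentiable; a power series is holomorphic in its disk
    ([pseries_cderiv]), and conversely Cauchy's formula
    ([Cauchy_formula_kernel]) gives a Taylor series that converges in the
    largest disk where the function is holomorphic ([Taylor_ball]).  Cauchy's
    formula is obtained by contracting the circle to the point: the derivative
    of the integral along the contraction is the integral of a periodic total
    derivative.  The factor [h = g / f] of a dominated function is holomorphic
    because its singularities, the zeros of [f], are isolated
    ([identity_theorem]) and removable ([dominated_factor]). *)

(** * Continuity of complex-valued maps *)

(** The carrier of a module or uniform space built on [C] or [R] is [C] or [R]
    itself; the change of type lets [ring] and [field] apply. *)
Ltac as_C := match goal with |- ?a = ?b => change (@eq C a b) end.
Ltac as_R := match goal with |- ?a = ?b => change (@eq R a b) end.

Lemma locally_Cmod (z : C) (P : C -> Prop) :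
  locally z P <-> exists d, 0 < d /\ forall w, Cmod (w - z) < d -> P w.
Proof.
  split.
  - intros [eps H]. exists eps. split. apply cond_pos.
    intros w Hw. apply H. apply C_NormedModule_mixin_compat1. exact Hw.
  - intros [d [Hd H]].
    assert (H2 : 0 < sqrt 2) by (apply sqrt_lt_R0; lra).
    assert (Hp : 0 < d / sqrt 2) by (apply Rdiv_lt_0_compat; lra).
    exists (mkposreal _ Hp). intros w Hw. apply H.
    apply (C_NormedModule_mixin_compat2 z w) in Hw. simpl in Hw.
    replace (sqrt 2 * (d / sqrt 2)) with d in Hw by (field; lra).
    exact Hw.
Qed.

Section Continuity.
Context {T : UniformSpace}.
Implicit Types f g : T -> C.

Lemma continuous_C_pair f x :
  continuous (fun y => fst (f y)) x -> continuous (fun y => snd (f y)) x ->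
  continuous f x.
Proof.
  intros H1 H2.
  apply (continuous_ext (fun y => (fst (f y), snd (f y)))).
  intros y; symmetry; apply surjective_pairing.
  unfold continuous.
  replace (locally (fst (f x), snd (f x))) with (locally (f x)) by (now rewrite <- surjective_pairing).
  intros P [eps HP].
  specialize (H1 (ball (fst (f x)) eps) (locally_ball _ eps)).
  specialize (H2 (ball (snd (f x)) eps) (locally_ball _ eps)).
  unfold filtermap in *.
  generalize (filter_and _ _ H1 H2). apply filter_imp.
  intros y [h1 h2]. apply HP. split; assumption.
Qed.

Lemma continuous_Re f x : continuous f x -> continuous (fun y => fst (f y)) x.
Proof. intros H. apply (continuous_comp f fst). exact H. apply continuous_fst. Qed.

Lemma continuous_Im f x : continuous f x -> continuous (fun y => snd (f y)) x.
Proof. intros H. apply (continuous_comp f snd). exact H. apply continuous_snd. Qed.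

Lemma continuous_Cplus f g x :
  continuous f x -> continuous g x -> continuous (fun y => (f y + g y)%C) x.
Proof.
  intros Hf Hg. apply continuous_C_pair; simpl.
  - apply (continuous_plus (fun y => fst (f y)) (fun y => fst (g y))); now apply continuous_Re.
  - apply (continuous_plus (fun y => snd (f y)) (fun y => snd (g y))); now apply continuous_Im.
Qed.

Lemma continuous_Copp f x : continuous f x -> continuous (fun y => (- f y)%C) x.
Proof.
  intros Hf. apply continuous_C_pair; simpl.
  - apply (continuous_opp (fun y => fst (f y))); now apply continuous_Re.
  - apply (continuous_opp (fun y => snd (f y))); now apply continuous_Im.
Qed.

Lemma continuous_Cminus f g x :
  continuous f x -> continuous g x -> continuous (fun y => (f y - g y)%C) x.
Proof. intros. apply continuous_Cplus; auto. now apply continuous_Copp. Qed.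

Lemma continuous_Cmult f g x :
  continuous f x -> continuous g x -> continuous (fun y => (f y * g y)%C) x.
Proof.
  intros Hf Hg.
  pose proof (continuous_Re _ _ Hf) as H1. pose proof (continuous_Im _ _ Hf) as H2.
  pose proof (continuous_Re _ _ Hg) as H3. pose proof (continuous_Im _ _ Hg) as H4.
  apply continuous_C_pair; simpl.
  - apply (continuous_minus (fun y => fst (f y) * fst (g y)) (fun y => snd (f y) * snd (g y)));
    apply (continuous_mult (K := R_AbsRing)); assumption.
  - apply (continuous_plus (fun y => fst (f y) * snd (g y)) (fun y => snd (f y) * fst (g y)));
    apply (continuous_mult (K := R_AbsRing)); assumption.
Qed.

Lemma continuous_Cinv f x :
  continuous f x -> f x <> RtoC 0 -> continuous (fun y => (/ f y)%C) x.
Proof.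
  intros Hf Hx.
  pose proof (continuous_Re _ _ Hf) as H1. pose proof (continuous_Im _ _ Hf) as H2.
  assert (Hn : fst (f x) ^ 2 + snd (f x) ^ 2 <> 0).
  { intros h. apply Hx. apply injective_projections; simpl; nra. }
  assert (Hc : continuous (fun y => / (fst (f y) ^ 2 + snd (f y) ^ 2)) x).
  { apply (continuous_comp (fun y => fst (f y) ^ 2 + snd (f y) ^ 2) Rinv).
    - apply (continuous_plus (fun y => fst (f y) ^ 2) (fun y => snd (f y) ^ 2));
      apply (continuous_mult (K := R_AbsRing)); auto;
      apply (continuous_mult (K := R_AbsRing)); auto; apply continuous_const.
    - apply continuous_Rinv. exact Hn. }
  apply continuous_C_pair; simpl.
  - apply (continuous_mult (K := R_AbsRing)); assumption.
  - apply (continuous_mult (K := R_AbsRing)); auto.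
    now apply (continuous_opp (fun y => snd (f y))).
Qed.

Lemma continuous_Cpow f n x :
  continuous f x -> continuous (fun y => (f y ^ n)%C) x.
Proof.
  intros Hf. induction n as [|n IH]; simpl.
  - apply continuous_const.
  - now apply continuous_Cmult.
Qed.
End Continuity.

Lemma continuous_C_eps (f : C -> C) (z : C) :
  continuous f z <->
  forall eps, 0 < eps -> exists d, 0 < d /\ forall w, Cmod (w - z) < d -> Cmod (f w - f z) < eps.
Proof.
  split.
  - intros H eps He. apply locally_Cmod.
    apply (H (fun y => Cmod (y - f z) < eps)). apply locally_Cmod.
    exists eps. auto.
  - intros H P HP. apply locally_Cmod in HP. destruct HP as [e [He HP]].
    destruct (H e He) as [d [Hd Hw]]. unfold filtermap. apply locally_Cmod.
    exists d. split; auto.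
Qed.

(** * Power series *)

Lemma pow_n_Cpow (z : C) (n : nat) : pow_n (K := C_Ring) z n = (z ^ n)%C.
Proof. induction n as [|n IH]; simpl; [reflexivity|]. now rewrite IH. Qed.

Lemma is_pseries_C (A : nat -> C) (z l : C) :
  is_pseries A z l <-> is_series (V := C_NormedModule) (fun n => (A n * z ^ n)%C) l.
Proof.
  unfold is_pseries.
  assert (E : forall n, scal (V := C_NormedModule) (pow_n (K := C_AbsRing) z n) (A n) = (A n * z ^ n)%C).
  { intros n. etransitivity. 2: apply Cmult_comm.
    change (Cmult (pow_n (K := C_Ring) z n) (A n) = Cmult (z ^ n)%C (A n)).
    now rewrite pow_n_Cpow. }
  split; apply is_series_ext; intros n; rewrite E; reflexivity.
Qed.

Lemma Cmod_sum_n (a : nat -> C) n :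
  Cmod (sum_n (G := C_AbelianMonoid) a n) <= sum_n (fun k => Cmod (a k)) n.
Proof.
  exact (norm_sum_n_m (K := C_AbsRing) (V := C_NormedModule) a 0 n).
Qed.

Lemma is_series_C_unique (a : nat -> C) (l l' : C) :
  is_series (V := C_NormedModule) a l -> is_series (V := C_NormedModule) a l' -> l = l'.
Proof.
  intros H H'. exact (filterlim_locally_unique (F := eventually) _ _ _ H H').
Qed.

Lemma is_series_Cmod_le (a : nat -> C) (b : nat -> R) (l : C) (s : R) :
  is_series (V := C_NormedModule) a l -> is_series b s ->
  (forall n, Cmod (a n) <= b n) -> Cmod l <= s.
Proof.
  intros Ha Hb Hab.
  assert (H1 : is_lim_seq (fun n => Cmod (sum_n (G := C_AbelianMonoid) a n)) (Cmod l)).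
  { exact (filterlim_comp _ _ _ _ (fun x : C_NormedModule => norm x) _ _ _ Ha (filterlim_norm l)). }
  assert (H2 : is_lim_seq (sum_n b) s) by exact Hb.
  refine (is_lim_seq_le _ _ _ _ _ H1 H2).
  intros n. eapply Rle_trans. apply Cmod_sum_n.
  apply sum_n_m_le. exact Hab.
Qed.

Lemma ex_series_C_abs (a : nat -> C) :
  ex_series (fun n => Cmod (a n)) -> exists l, is_series (V := C_NormedModule) a l.
Proof.
  intros H.
  exact (ex_series_le (V := C_CompleteNormedModule) a _ (fun n => Rle_refl _) H).
Qed.

(** The terms of a convergent power series are bounded, so that the radius of
    convergence of the series of moduli is at least [rho]. *)
Lemma CV_radius_Cmod (A : nat -> C) (rho : R) :
  (forall x, 0 <= x < rho -> exists l, is_pseries A (RtoC x) l) ->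
  Rbar_le rho (CV_radius (fun n => Cmod (A n))).
Proof.
  intros H.
  assert (Hx : forall x, 0 <= x < rho -> Rbar_le x (CV_radius (fun n => Cmod (A n)))).
  { intros x Hx. destruct (H x Hx) as [l Hl]. apply (proj1 (is_pseries_C _ _ _)) in Hl.
    apply (proj1 (CV_radius_bounded _)).
    (* Each term is a difference of two partial sums, and those are bounded. *)
    destruct (filterlim_bounded (V := C_NormedModule) _ (ex_intro _ l Hl)) as [M HM].
    assert (HM' : forall n, Cmod (sum_n (G := C_AbelianMonoid) (fun n => (A n * x ^ n)%C) n) <= M)
      by exact HM.
    exists (M + M). intros n.
    assert (E : Rabs (Cmod (A n) * x ^ n) = Cmod (A n * x ^ n)%C).
    { rewrite Cmod_mult, <- RtoC_pow, Cmod_R, Rabs_mult. f_equal.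
      apply Rabs_pos_eq, Cmod_ge_0. }
    rewrite E. pose proof (Rle_trans _ _ _ (Cmod_ge_0 _) (HM' 0%nat)) as M0.
    destruct n as [|n].
    - specialize (HM' 0%nat). rewrite sum_O in HM'. lra.
    - replace (A (S n) * x ^ (S n))%C with
        (sum_n (G := C_AbelianMonoid) (fun n => (A n * x ^ n)%C) (S n) +
          - sum_n (G := C_AbelianMonoid) (fun n => (A n * x ^ n)%C) n)%C.
      + eapply Rle_trans. apply Cmod_triangle. rewrite Cmod_opp.
        apply Rplus_le_compat; apply HM'.
      + rewrite sum_Sn. unfold plus; simpl. ring. }
  destruct (Rle_lt_dec rho 0) as [H0|H0].
  { eapply Rbar_le_trans. 2: apply (CV_radius_ge_0). exact H0. }
  destruct (CV_radius (fun n => Cmod (A n))) as [c| |] eqn:E; simpl; auto.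
  - destruct (Rle_lt_dec rho c) as [h|h]; auto. exfalso.
    pose proof (CV_radius_ge_0 (fun n => Cmod (A n))) as h0. rewrite E in h0. simpl in h0.
    specialize (Hx ((c + rho)/2)). simpl in Hx. lra.
  - specialize (Hx 0). simpl in Hx. lra.
Qed.

Lemma pseries_CV_radius (A : nat -> C) (F : C -> C) (rho : R)
  (HF : forall z, Cmod z < rho -> is_pseries A z (F z)) x :
  0 <= x < rho ->
  Rbar_lt (Rabs x) (CV_radius (fun n => Cmod (A n))).
Proof.
  intros Hx. apply Rbar_lt_le_trans with rho.
  rewrite Rabs_pos_eq; simpl; lra.
  apply CV_radius_Cmod. intros y Hy. exists (F y). apply HF. rewrite Cmod_R, Rabs_pos_eq; lra.
Qed.

Lemma pseries_abs (A : nat -> C) (F : C -> C) (rho : R)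
  (HF : forall z, Cmod z < rho -> is_pseries A z (F z)) x :
  0 <= x < rho ->
  ex_series (fun n => Cmod (A n) * x ^ n).
Proof.
  intros Hx. apply (proj1 (ex_pseries_R (fun n => Cmod (A n)) x)).
  apply CV_radius_inside. now apply (pseries_CV_radius A F rho).
Qed.

Lemma pseries_abs_derive (A : nat -> C) (F : C -> C) (rho : R)
  (HF : forall z, Cmod z < rho -> is_pseries A z (F z)) x :
  0 <= x < rho ->
  ex_series (fun n => INR (S n) * Cmod (A (S n)) * x ^ n).
Proof.
  intros Hx.
  apply (proj1 (ex_pseries_R (PS_derive (fun n => Cmod (A n))) x)).
  apply CV_radius_inside. rewrite CV_radius_derive. now apply (pseries_CV_radius A F rho).
Qed.

Lemma pseries_abs_derive2 (A : nat -> C) (F : C -> C) (rho : R)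
  (HF : forall z, Cmod z < rho -> is_pseries A z (F z)) x :
  0 <= x < rho ->
  ex_series (fun n => INR (S n) * (INR (S (S n)) * Cmod (A (S (S n)))) * x ^ n).
Proof.
  intros Hx.
  apply (proj1 (ex_pseries_R (PS_derive (PS_derive (fun n => Cmod (A n)))) x)).
  apply CV_radius_inside. rewrite !CV_radius_derive. now apply (pseries_CV_radius A F rho).
Qed.

Lemma is_pseries_at_0 (A : nat -> C) l : is_pseries A (RtoC 0) l -> l = A 0%nat.
Proof.
  intros H. apply (proj1 (is_pseries_C _ _ _)) in H.
  assert (H0 := is_pseries_0 (K := C_AbsRing) (V := C_NormedModule) A).
  apply (proj1 (is_pseries_C A (RtoC 0) _)) in H0.
  exact (is_series_C_unique _ _ _ H H0).
Qed.

Lemma is_pseries_decr (A : nat -> C) z l : z <> RtoC 0 ->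
  is_pseries A z l -> is_pseries (fun n => A (S n)) z ((l - A 0%nat) / z)%C.
Proof.
  intros Hz H.
  replace ((l - A 0%nat) / z)%C with (scal (V := C_NormedModule) (/ z)%C (plus l (opp (A 0%nat)))).
  - apply (is_pseries_decr_1 (K := C_AbsRing) (V := C_NormedModule) A z (/ z)%C l).
    now apply Cinv_l. exact H.
  - apply Cmult_comm.
Qed.

Lemma is_pseries_incr (A : nat -> C) z l :
  is_pseries (fun n => A (S n)) z l -> is_pseries A z (A 0%nat + z * l)%C.
Proof.
  intros H. apply is_pseries_C. apply is_series_decr_1.
  apply (proj1 (is_pseries_C _ _ _)) in H.
  apply (is_series_scal (V := C_NormedModule) z) in H.
  match goal with |- is_series _ ?L => replace L with (scal (V := C_NormedModule) z l) end.
  - revert H. apply is_series_ext. intros n.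
    change (z * (A (S n) * z ^ n) = A (S n) * z ^ (S n))%C. simpl. ring.
  - change (z * l = A 0%nat + z * l + - (A 0%nat * z ^ 0))%C. simpl. ring.
Qed.

(** [(F z - A 0) / z], with the value at [0] that keeps it the sum of the
    shifted series. *)
Definition shift_fun (A : nat -> C) (F : C -> C) (z : C) : C :=
  if excluded_middle_informative (z = RtoC 0) then A 1%nat else ((F z - A 0%nat) / z)%C.

Lemma shift_fun_pseries (A : nat -> C) (F : C -> C) (rho : R) :
  (forall z, Cmod z < rho -> is_pseries A z (F z)) ->
  forall z, Cmod z < rho -> is_pseries (fun n => A (S n)) z (shift_fun A F z).
Proof.
  intros H z Hz. unfold shift_fun. destruct (excluded_middle_informative _) as [->|n].
  - exact (is_pseries_0 (K := C_AbsRing) (V := C_NormedModule) (fun n => A (S n))).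
  - apply is_pseries_decr; auto.
Qed.

Lemma shift_fun_eq (A : nat -> C) (F : C -> C) (rho : R) :
  (forall z, Cmod z < rho -> is_pseries A z (F z)) ->
  forall z, Cmod z < rho -> F z = (A 0%nat + z * shift_fun A F z)%C.
Proof.
  intros H z Hz. unfold shift_fun. destruct (excluded_middle_informative _) as [->|n].
  - rewrite (is_pseries_at_0 A _ (H _ Hz)). ring.
  - field. exact n.
Qed.

(** Iterated division by [z]: [G] is the sum of the series shifted by [m].
    The partial sum includes the index [m], hence the subtraction of [A m]. *)
Lemma pseries_shift (A : nat -> C) (F : C -> C) (rho : R) m :
  (forall z, Cmod z < rho -> is_pseries A z (F z)) ->
  exists G : C -> C, (forall z, Cmod z < rho -> is_pseries (fun n => A (m + n)%nat) z (G z)) /\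
    forall z, Cmod z < rho -> (F z - sum_n (G := C_AbelianMonoid) (fun k => A k * z ^ k)%C m = z ^ m * (G z - A m))%C.
Proof.
  intros H. induction m as [|m [G [HG1 HG2]]].
  - exists F. split. exact H. intros z Hz. rewrite sum_O. simpl. ring.
  - exists (shift_fun (fun n => A (m + n)%nat) G). split.
    + intros z Hz. assert (K := shift_fun_pseries _ _ _ HG1 z Hz).
      revert K. apply is_pseries_ext. intros n. f_equal. lia.
    + intros z Hz. assert (K := shift_fun_eq _ _ _ HG1 z Hz).
      rewrite sum_Sn. specialize (HG2 z Hz). unfold plus; simpl.
      set (s := sum_n (G := C_AbelianMonoid) (fun k => (A k * z ^ k)%C) m) in *.
      set (h := shift_fun _ _ _) in *.
      cbv beta in K. rewrite Nat.add_0_r in K.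
      assert (E : (F z = s + z ^ m * (G z - A m))%C) by (rewrite <- HG2; ring).
      rewrite E, K. ring.
Qed.

Lemma pseries_factor (A : nat -> C) (F : C -> C) (rho : R) n :
  (forall z, Cmod z < rho -> is_pseries A z (F z)) ->
  (forall k, (k < n)%nat -> A k = RtoC 0) ->
  exists G : C -> C, (forall z, Cmod z < rho -> is_pseries (fun k => A (n + k)%nat) z (G z)) /\
    forall z, Cmod z < rho -> F z = (z ^ n * G z)%C.
Proof.
  intros HA H0. destruct (pseries_shift A F rho n HA) as [G [HG1 HG2]].
  exists G. split; auto. intros z Hz. specialize (HG2 z Hz).
  assert (E : sum_n (G := C_AbelianMonoid) (fun k => A k * z ^ k)%C n = (A n * z ^ n)%C).
  { assert (Em : forall m, (m < n)%nat -> sum_n (G := C_AbelianMonoid) (fun k => A k * z ^ k)%C m = RtoC 0).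
    { induction m as [|m IH]; intros Hm. rewrite sum_O, H0 by auto. as_C. ring.
      rewrite sum_Sn, IH, H0 by lia. unfold plus; simpl. as_C. ring. }
    destruct n as [|m]. now rewrite sum_O. rewrite sum_Sn, Em by lia. unfold plus; simpl. as_C. ring. }
  rewrite E in HG2. replace (F z) with (F z - A n * z ^ n + A n * z ^ n)%C by ring. rewrite HG2. ring.
Qed.

Lemma pseries_bounded (A : nat -> C) (F : C -> C) (rho : R) x :
  (forall z, Cmod z < rho -> is_pseries A z (F z)) -> 0 <= x < rho ->
  exists M, forall z, Cmod z <= x -> Cmod (F z) <= M.
Proof.
  intros H Hx. destruct (pseries_abs A F rho H x Hx) as [M HM].
  exists M. intros z Hz.
  assert (K := proj1 (is_pseries_C _ _ _) (H z ltac:(lra))).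
  apply (is_series_Cmod_le _ _ _ _ K HM).
  intros n. rewrite Cmod_mult, Cmod_pow. apply Rmult_le_compat_l. apply Cmod_ge_0.
  apply pow_incr. split. apply Cmod_ge_0. exact Hz.
Qed.

Lemma pseries_tail (A : nat -> C) (F : C -> C) (rho : R) x m :
  (forall z, Cmod z < rho -> is_pseries A z (F z)) -> 0 <= x < rho ->
  exists M, forall z, Cmod z <= x ->
    Cmod (F z - sum_n (G := C_AbelianMonoid) (fun k => A k * z ^ k)%C m)%C <= M * Cmod z ^ S m.
Proof.
  intros H Hx.
  destruct (pseries_shift A F rho (S m) H) as [G [HG1 HG2]].
  destruct (pseries_bounded _ _ _ _ HG1 Hx) as [M HM].
  exists M. intros z Hz. specialize (HG2 z ltac:(lra)).
  rewrite sum_Sn in HG2. unfold plus in HG2; simpl in HG2.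
  set (s := sum_n _ _) in *.
  replace (F z - s)%C with (z ^ S m * G z)%C.
  - rewrite Cmod_mult, Cmod_pow, Rmult_comm. apply Rmult_le_compat_r.
    apply pow_le, Cmod_ge_0. apply HM; lra.
  - assert (E : (F z = s + A (S m) * (z * z ^ m) + z * z ^ m * (G z - A (S m)))%C) by (rewrite <- HG2; ring).
    rewrite E. simpl. ring.
Qed.

(** Carathéodory's form of the complex derivative: the difference quotient
    extends continuously to [z] with value [d]. *)
Definition cderiv (f : C -> C) (z d : C) : Prop :=
  exists q : C -> C, continuous q z /\ q z = d /\
    locally z (fun w => (f w - f z = q w * (w - z))%C).

Lemma cderiv_of_quadratic (f : C -> C) z d M delta :
  0 < delta ->
  (forall w, Cmod (w - z) < delta -> Cmod (f w - f z - d * (w - z)) <= M * Cmod (w - z) ^ 2) ->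
  cderiv f z d.
Proof.
  intros Hd H.
  exists (fun w => if excluded_middle_informative (w = z) then d else ((f w - f z) / (w - z))%C).
  split; [|split].
  - apply continuous_C_eps. intros eps He.
    exists (Rmin delta (eps / (Rabs M + 1))).
    assert (HM := Rabs_pos M). assert (HM2 := Rle_abs M).
    assert (0 < eps / (Rabs M + 1)) by (apply Rdiv_lt_0_compat; lra).
    split. now apply Rmin_pos.
    intros w Hw. destruct (excluded_middle_informative (z = z)) as [_|n]; [|now contradict n].
    destruct (excluded_middle_informative (w = z)) as [_|n].
    + replace (d - d)%C with (RtoC 0) by ring. now rewrite Cmod_0.
    + assert (Hn : (w - z)%C <> RtoC 0) by now apply Cminus_eq_contra.
      assert (Hp := proj1 (Cmod_gt_0 _) Hn).
      specialize (H w (Rlt_le_trans _ _ _ Hw (Rmin_l _ _))).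
      replace (f w - f z - d * (w - z))%C with (((f w - f z) / (w - z) - d) * (w - z))%C in H by (field; exact Hn).
      rewrite Cmod_mult in H.
      assert (H' : Cmod ((f w - f z) / (w - z) - d) <= M * Cmod (w - z)) by nra.
      assert (Hw2 := Rlt_le_trans _ _ _ Hw (Rmin_r _ _)).
      apply Rle_lt_trans with (1 := H').
      apply Rle_lt_trans with ((Rabs M + 1) * Cmod (w - z)). nra.
      apply (Rmult_lt_compat_l (Rabs M + 1)) in Hw2; [|lra].
      replace ((Rabs M + 1) * (eps / (Rabs M + 1))) with eps in Hw2 by (field; lra). exact Hw2.
  - destruct (excluded_middle_informative (z = z)) as [_|n]; [reflexivity|now contradict n].
  - apply filter_forall. intros w. destruct (excluded_middle_informative (@eq C w z)) as [->|n].
    + ring.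
    + field. now apply Cminus_eq_contra.
Qed.

(** With [D_n = w^n - z^n - n z^(n-1) (w - z)], the induction rests on the
    identity [D_(n+1) = w D_n + n z^(n-1) (w - z)^2]. *)
Lemma Cpow_remainder (w z : C) y n :
  Cmod w <= y -> Cmod z <= y ->
  Cmod (w ^ (S (S n)) - z ^ (S (S n)) - INR (S (S n)) * z ^ (S n) * (w - z))%C
  <= INR (S n) * INR (S (S n)) * y ^ n * Cmod (w - z) ^ 2.
Proof.
  intros Hw Hz. assert (Hy := Rle_trans _ _ _ (Cmod_ge_0 w) Hw).
  assert (Hq := pow2_ge_0 (Cmod (w - z))).
  induction n as [|n IH].
  - replace (w ^ 2 - z ^ 2 - INR 2 * z ^ 1 * (w - z))%C with ((w - z) ^ 2)%C.
    + rewrite Cmod_pow. change (INR 1) with 1. change (INR 2) with (1 + 1). simpl (y ^ 0). lra.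
    + change (INR 2) with (1 + 1). rewrite RtoC_plus. ring.
  - replace (w ^ S (S (S n)) - z ^ S (S (S n)) - INR (S (S (S n))) * z ^ S (S n) * (w - z))%C
      with (w * (w ^ S (S n) - z ^ S (S n) - INR (S (S n)) * z ^ S n * (w - z))
            + INR (S (S n)) * z ^ S n * (w - z) ^ 2)%C.
    2:{ rewrite (S_INR (S (S n))), RtoC_plus. simpl Cpow. ring. }
    eapply Rle_trans. apply Cmod_triangle. rewrite !Cmod_mult, !Cmod_pow, Cmod_R, Rabs_pos_eq by apply pos_INR.
    set (D := Cmod (_ - _ - _)) in *. set (Q := Cmod (w - z) ^ 2) in *.
    assert (HD : Cmod w * D <= y * (INR (S n) * INR (S (S n)) * y ^ n * Q)).
    { apply Rmult_le_compat; auto; apply Cmod_ge_0. }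
    assert (Hz' : Cmod z ^ S n <= y ^ S n) by (apply pow_incr; split; [apply Cmod_ge_0|auto]).
    assert (HE : INR (S (S n)) * Cmod z ^ S n * Q <= INR (S (S n)) * y ^ S n * Q).
    { apply Rmult_le_compat_r; auto. apply Rmult_le_compat_l; auto. apply pos_INR. }
    eapply Rle_trans. apply Rplus_le_compat; eassumption.
    assert (P := pow_le y (S n) Hy).
    assert (P2 : 0 <= y ^ S n * Q) by now apply Rmult_le_pos.
    assert (I := pos_INR (S (S n))).
    rewrite (S_INR (S (S n))). rewrite (S_INR (S n)) in *.
    simpl (y ^ S n) in *.
    assert (0 <= INR (S n) + 1) by (assert (0 <= INR (S n)) by apply pos_INR; lra).
    assert (0 <= (INR (S n) + 1) * (y * y ^ n * Q)) by (apply Rmult_le_pos; lra).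
    nra.
Qed.

Definition psum (A : nat -> C) (z : C) : C :=
  epsilon (inhabits (RtoC 0)) (fun l => is_pseries A z l).

Definition ps_deriv (A : nat -> C) (n : nat) : C := (INR (S n) * A (S n))%C.

Lemma ps_deriv_pseries (A : nat -> C) (F : C -> C) (rho : R) :
  (forall z, Cmod z < rho -> is_pseries A z (F z)) ->
  forall z, Cmod z < rho -> is_pseries (ps_deriv A) z (psum (ps_deriv A) z).
Proof.
  intros H z Hz. unfold psum. apply epsilon_spec.
  assert (Hx : 0 <= Cmod z < rho) by (split; [apply Cmod_ge_0|auto]).
  destruct (ex_series_C_abs (fun n => ps_deriv A n * z ^ n)%C) as [l Hl].
  - generalize (pseries_abs_derive A F rho H _ Hx). apply ex_series_ext. intros n.
    unfold ps_deriv. rewrite !Cmod_mult, Cmod_pow, Cmod_R, Rabs_pos_eq by apply pos_INR. reflexivity.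
  - exists l. now apply is_pseries_C.
Qed.

(** The second-order remainders of the monomials add up to a quadratic error,
    because the twice differentiated series still converges absolutely. *)
Lemma pseries_cderiv (A : nat -> C) (F : C -> C) (rho : R) :
  (forall z, Cmod z < rho -> is_pseries A z (F z)) ->
  forall z, Cmod z < rho -> cderiv F z (psum (ps_deriv A) z).
Proof.
  intros H z Hz. assert (Hd := ps_deriv_pseries A F rho H z Hz).
  set (d := psum (ps_deriv A) z) in *.
  set (y := (Cmod z + rho) / 2). assert (Hz0 := Cmod_ge_0 z).
  assert (Hy : 0 <= y < rho) by (unfold y; lra).
  destruct (pseries_abs_derive2 A F rho H y Hy) as [M HM].
  apply cderiv_of_quadratic with (M := M) (delta := y - Cmod z). unfold y; lra.
  intros w Hw.
  assert (Hwy : Cmod w <= y).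
  { replace w with ((w - z) + z)%C by ring. eapply Rle_trans. apply Cmod_triangle. lra. }
  assert (Sw := proj1 (is_pseries_C _ _ _) (H w ltac:(lra))).
  assert (Sz := proj1 (is_pseries_C _ _ _) (H z Hz)).
  assert (Sd : is_series (V := C_NormedModule) (fun n => A n * (INR n * z ^ pred n))%C d).
  { apply is_series_decr_1. apply (proj1 (is_pseries_C _ _ _)) in Hd.
    match goal with |- is_series _ ?L => replace L with d end.
    - revert Hd. apply is_series_ext. intros n. unfold ps_deriv. simpl pred.
      as_C. ring.
    - change (d = d + - (A 0%nat * (INR 0 * z ^ 0)))%C. change (INR 0) with 0. ring. }
  assert (St := is_series_minus _ _ _ _ (is_series_minus _ _ _ _ Sw Sz) (is_series_scal (V := C_NormedModule) (w - z)%C _ _ Sd)).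
  set (t := fun n => (A n * (w ^ n - z ^ n - INR n * z ^ pred n * (w - z)))%C).
  assert (St' : is_series (V := C_NormedModule) t (F w - F z - d * (w - z))%C).
  { replace (F w - F z - d * (w - z))%C with (F w - F z - (w - z) * d)%C by ring.
    revert St. apply is_series_ext. intros n. unfold t.
    change (A n * w ^ n - A n * z ^ n - (w - z) * (A n * (INR n * z ^ pred n))
      = A n * (w ^ n - z ^ n - INR n * z ^ pred n * (w - z)))%C. ring. }
  (* The terms of index 0 and 1 of the remainder vanish. *)
  assert (S2 : is_series (V := C_NormedModule) (fun n => t (2 + n)%nat) (F w - F z - d * (w - z))%C).
  { apply is_series_incr_n. lia.
    match goal with |- is_series _ ?L => replace L with (F w - F z - d * (w - z))%C end.
    exact St'. simpl pred. rewrite sum_Sn, sum_O. unfold plus; simpl. unfold t. simpl.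
    as_C. ring. }
  apply (is_series_scal_r (Cmod (w - z) ^ 2)) in HM.
  apply (is_series_Cmod_le _ _ _ _ S2 HM).
  intros n. change (2 + n)%nat with (S (S n)).
  unfold t. simpl pred.
  rewrite Cmod_mult.
  assert (K := Cpow_remainder w z y n Hwy ltac:(unfold y; lra)).
  apply (Rmult_le_compat_l (Cmod (A (S (S n))))) in K; [|apply Cmod_ge_0].
  eapply Rle_trans. exact K. apply Req_le. ring.
Qed.

(** * Holomorphic functions *)

Lemma cderiv_continuous (f : C -> C) z d : cderiv f z d -> continuous f z.
Proof.
  intros [q [Hq [_ Hl]]].
  apply (continuous_ext_loc f (fun w => (f z + q w * (w - z))%C) z).
  - revert Hl. apply filter_imp. intros w Hw. rewrite <- Hw. as_C. ring.
  - apply continuous_Cplus. apply continuous_const. apply continuous_Cmult; auto.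
    apply continuous_Cminus. apply continuous_id. apply continuous_const.
Qed.

Lemma cderiv_C_derive (f : C -> C) z d : cderiv f z d -> C_derive f z = d.
Proof.
  intros [q [Hq [<- Hl]]]. unfold C_derive. apply is_C_lim_unique.
  apply filterlim_ext_loc with q.
  - unfold locally', within. revert Hl. apply filter_imp.
    intros w Hw n. rewrite Hw. as_C. field. now apply Cminus_eq_contra.
  - intros P HP. specialize (Hq P HP). unfold filtermap, locally', within in *.
    revert Hq. apply filter_imp. auto.
Qed.

Lemma cderiv_ext_loc (f g : C -> C) z d :
  locally z (fun w => f w = g w) -> cderiv f z d -> cderiv g z d.
Proof.
  intros He [q [Hq [<- Hl]]]. exists q. split; [auto|split;[auto|]].
  assert (E := locally_singleton _ _ He). cbv beta in E.
  generalize (filter_and _ _ He Hl). apply filter_imp. intros w [<- h]. now rewrite <- E.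
Qed.

Lemma cderiv_const (c z : C) : cderiv (fun _ => c) z (RtoC 0).
Proof.
  exists (fun _ => RtoC 0). split; [apply continuous_const|split;[auto|]].
  apply filter_forall. intros w. as_C. ring.
Qed.

Lemma cderiv_id (z : C) : cderiv (fun w => w) z (RtoC 1).
Proof.
  exists (fun _ => RtoC 1). split; [apply continuous_const|split;[auto|]].
  apply filter_forall. intros w. as_C. ring.
Qed.

Lemma cderiv_mult (f g : C -> C) z df dg : cderiv f z df -> cderiv g z dg ->
  cderiv (fun w => f w * g w)%C z (df * g z + f z * dg)%C.
Proof.
  intros Hf Hg. assert (Cg := cderiv_continuous _ _ _ Hg).
  destruct Hf as [p [Hp [<- Hlp]]]. destruct Hg as [q [Hq [<- Hlq]]].
  exists (fun w => p w * g w + f z * q w)%C. split; [|split;[auto|]].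
  - apply continuous_Cplus; apply continuous_Cmult; auto. apply continuous_const.
  - generalize (filter_and _ _ Hlp Hlq). apply filter_imp. intros w [h k].
    replace (f w * g w - (f z * g z))%C with ((f w - f z) * g w + f z * (g w - g z))%C by ring.
    rewrite h, k. as_C. ring.
Qed.

Lemma locally_neq_0 (f : C -> C) z : continuous f z -> f z <> RtoC 0 ->
  locally z (fun w => f w <> RtoC 0).
Proof.
  intros Hf Hz. apply (Hf (fun y => y <> RtoC 0)).
  apply locally_Cmod. exists (Cmod (f z)). split. now apply Cmod_gt_0.
  intros w Hw ->. replace (RtoC 0 - f z)%C with (- f z)%C in Hw by ring.
  rewrite Cmod_opp in Hw. lra.
Qed.

Lemma cderiv_inv (f : C -> C) z df : cderiv f z df -> f z <> RtoC 0 ->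
  cderiv (fun w => / f w)%C z (- (df / (f z * f z)))%C.
Proof.
  intros Hf Hz. assert (Cf := cderiv_continuous _ _ _ Hf).
  destruct Hf as [p [Hp [<- Hlp]]].
  exists (fun w => - (p w / (f w * f z)))%C. split; [|split;[auto|]].
  - apply continuous_Copp. apply continuous_Cmult; auto.
    apply continuous_Cinv.
    + apply continuous_Cmult; auto. apply continuous_const.
    + now apply Cmult_neq_0.
  - generalize (filter_and _ _ Hlp (locally_neq_0 _ _ Cf Hz)). apply filter_imp. intros w [h k].
    replace (/ f w - / f z)%C with (- (f w - f z) / (f w * f z))%C by (field; auto).
    rewrite h. as_C. field. auto.
Qed.

Lemma cderiv_translate (f : C -> C) z0 z d :
  cderiv (fun u => f (z0 + u)%C) (z - z0)%C d -> cderiv f z d.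
Proof.
  intros [q [Hq [<- Hl]]].
  exists (fun w => q (w - z0)%C). split; [|split;[auto|]].
  - apply (continuous_comp (fun w => w - z0)%C q); auto.
    apply continuous_Cminus. apply continuous_id. apply continuous_const.
  - apply locally_Cmod in Hl. destruct Hl as [e [He Hl]].
    apply locally_Cmod. exists e. split; auto. intros w Hw.
    specialize (Hl (w - z0)%C).
    replace (w - z0 - (z - z0))%C with (w - z)%C in Hl by ring.
    replace (z0 + (w - z0))%C with w in Hl by ring.
    replace (z0 + (z - z0))%C with z in Hl by ring.
    now apply Hl.
Qed.

(** Continuous differentiability near the point is part of the notion, so that
    the Cauchy theorem below only needs differentiation under the integral. *)
Definition holo_at (f : C -> C) (z : C) : Prop :=
  exists df : C -> C, locally z (fun w => cderiv f w (df w) /\ continuous df w).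

Lemma holo_at_C_derive f z : holo_at f z ->
  cderiv f z (C_derive f z) /\ continuous (C_derive f) z.
Proof.
  intros [df H]. destruct (locally_singleton _ _ H) as [H1 H2].
  split.
  - rewrite (cderiv_C_derive _ _ _ H1). exact H1.
  - apply (continuous_ext_loc (C_derive f) df z); auto.
    revert H. apply filter_imp. intros w [h _]. symmetry. now apply cderiv_C_derive.
Qed.

Lemma holo_at_continuous f z : holo_at f z -> continuous f z.
Proof. intros H. eapply cderiv_continuous. apply holo_at_C_derive, H. Qed.

Lemma holo_at_ext_loc f g z :
  locally z (fun w => f w = g w) -> holo_at f z -> holo_at g z.
Proof.
  intros He [df H]. exists df. apply locally_locally in He.
  generalize (filter_and _ _ He H). apply filter_imp. intros w [h [k1 k2]].
  split; auto. now apply cderiv_ext_loc with f.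
Qed.

Lemma holo_at_const (c z : C) : holo_at (fun _ => c) z.
Proof.
  exists (fun _ => RtoC 0). apply filter_forall. intros w. split.
  apply cderiv_const. apply continuous_const.
Qed.

Lemma holo_at_id (z : C) : holo_at (fun w => w) z.
Proof.
  exists (fun _ => RtoC 1). apply filter_forall. intros w. split.
  apply cderiv_id. apply continuous_const.
Qed.

Lemma holo_at_mult f g z : holo_at f z -> holo_at g z -> holo_at (fun w => f w * g w)%C z.
Proof.
  intros [df H] [dg K]. exists (fun w => df w * g w + f w * dg w)%C.
  generalize (filter_and _ _ H K). apply filter_imp. intros w [[h1 h2] [k1 k2]].
  split. now apply cderiv_mult.
  apply continuous_Cplus; apply continuous_Cmult; auto; eapply cderiv_continuous; eassumption.
Qed.

Lemma holo_at_inv f z : holo_at f z -> f z <> RtoC 0 -> holo_at (fun w => / f w)%C z.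
Proof.
  intros Hf Hz. assert (Cf := holo_at_continuous _ _ Hf). destruct Hf as [df H].
  exists (fun w => - (df w / (f w * f w)))%C.
  generalize (filter_and _ _ H (locally_neq_0 _ _ Cf Hz)). apply filter_imp.
  intros w [[h1 h2] k]. split. now apply cderiv_inv.
  assert (Cw := cderiv_continuous _ _ _ h1).
  apply continuous_Copp. apply continuous_Cmult; auto. apply continuous_Cinv.
  now apply continuous_Cmult. now apply Cmult_neq_0.
Qed.

Lemma holo_at_pow f n z : holo_at f z -> holo_at (fun w => f w ^ n)%C z.
Proof.
  intros H. induction n as [|n IH]; simpl. apply holo_at_const. now apply holo_at_mult.
Qed.

Lemma holo_at_pseries (A : nat -> C) (F : C -> C) (z0 : C) (rho : R) :
  (forall z, Cmod (z - z0) < rho -> is_pseries A (z - z0)%C (F z)) ->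
  forall z, Cmod (z - z0) < rho -> holo_at F z.
Proof.
  intros H z Hz.
  assert (H0 : forall u, Cmod u < rho -> is_pseries A u (F (z0 + u)%C)).
  { intros u Hu. specialize (H (z0 + u)%C). replace (z0 + u - z0)%C with u in H by ring. auto. }
  exists (fun w => psum (ps_deriv A) (w - z0)%C).
  apply locally_Cmod. exists (rho - Cmod (z - z0)). split. lra.
  intros w Hw.
  assert (Hw' : Cmod (w - z0) < rho).
  { replace (w - z0)%C with ((w - z) + (z - z0))%C by ring.
    eapply Rle_lt_trans. apply Cmod_triangle. lra. }
  split.
  - apply cderiv_translate with z0.
    exact (pseries_cderiv A _ rho H0 _ Hw').
  - apply (continuous_comp (fun w => w - z0)%C (psum (ps_deriv A))).
    + apply continuous_Cminus. apply continuous_id. apply continuous_const.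
    + eapply cderiv_continuous.
      exact (pseries_cderiv _ _ rho (ps_deriv_pseries A _ rho H0) _ Hw').
Qed.

Lemma analytic_at_holo f z : analytic_at f z -> holo_at f z.
Proof.
  intros [A [rho [Hr H]]]. apply (holo_at_pseries A f z rho H).
  replace (z - z)%C with (RtoC 0) by ring. now rewrite Cmod_0.
Qed.

(** * Cauchy's integral formula *)

(** Carathéodory's form again, so that the chain rule with [cderiv] is a
    product of quotients. *)
Definition pderiv (p : R -> C) (t : R) (d : C) : Prop :=
  exists q : R -> C, continuous q t /\ q t = d /\
    locally t (fun u => (p u - p t = q u * RtoC (u - t))%C).

Lemma is_derive_of_quotient (f q : R -> R) t :
  continuous q t -> locally t (fun u => f u - f t = q u * (u - t)) -> is_derive f t (q t).
Proof.
  intros Hq Hl. apply is_derive_Reals. intros eps He.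
  assert (Hq' := Hq (fun y => Rabs (y - q t) < eps)).
  destruct (filter_and _ _ Hl (Hq' ltac:(exists (mkposreal eps He); intros y hy; exact hy))) as [d Hd].
  exists d. intros h hh Hh. destruct (Hd (t + h)) as [E1 E2].
  - change (Rabs (t + h - t) < d). now replace (t + h - t) with h by ring.
  - rewrite E1. replace (q (t + h) * (t + h - t) / h) with (q (t + h)) by (field; auto). exact E2.
Qed.

Lemma is_derive_quotient (f : R -> R) t l : is_derive f t l ->
  exists q, continuous q t /\ q t = l /\ forall u, f u - f t = q u * (u - t).
Proof.
  intros H. apply is_derive_Reals in H.
  exists (fun u => if Req_EM_T u t then l else (f u - f t) / (u - t)).
  split; [|split].
  - intros P [eps HP]. destruct (Req_EM_T t t) as [_|n]; [|now contradict n].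
    destruct (H eps (cond_pos eps)) as [d Hd]. exists d. intros u Hu. apply HP.
    destruct (Req_EM_T u t) as [_|n]. apply ball_center.
    change R in u. specialize (Hd (u - t) ltac:(lra) Hu). replace (t + (u - t)) with u in Hd by ring. exact Hd.
  - destruct (Req_EM_T t t) as [_|n]; [auto|now contradict n].
  - intros u. destruct (Req_EM_T u t) as [->|n]. ring. field. lra.
Qed.

Lemma pderiv_Re p t d : pderiv p t d -> is_derive (fun u => fst (p u)) t (fst d).
Proof.
  intros [q [Hq [<- Hl]]]. apply (is_derive_of_quotient _ (fun u => fst (q u))).
  now apply continuous_Re. revert Hl. apply filter_imp. intros u Hu.
  apply (f_equal fst) in Hu. simpl in Hu. nra.
Qed.

Lemma pderiv_Im p t d : pderiv p t d -> is_derive (fun u => snd (p u)) t (snd d).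
Proof.
  intros [q [Hq [<- Hl]]]. apply (is_derive_of_quotient _ (fun u => snd (q u))).
  now apply continuous_Im. revert Hl. apply filter_imp. intros u Hu.
  apply (f_equal snd) in Hu. simpl in Hu. nra.
Qed.

Lemma pderiv_pair (p : R -> C) t d : is_derive (fun u => fst (p u)) t (fst d) ->
  is_derive (fun u => snd (p u)) t (snd d) -> pderiv p t d.
Proof.
  intros H1 H2. destruct (is_derive_quotient _ _ _ H1) as [q1 [a1 [b1 c1]]].
  destruct (is_derive_quotient _ _ _ H2) as [q2 [a2 [b2 c2]]].
  exists (fun u => (q1 u, q2 u)). split; [|split].
  - now apply continuous_C_pair.
  - rewrite b1, b2. symmetry. apply surjective_pairing.
  - apply filter_forall. intros u. apply injective_projections; simpl.
    rewrite <- (Rplus_0_r (_ * _)). specialize (c1 u). lra. specialize (c2 u). lra.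
Qed.

Lemma pderiv_continuous p t d : pderiv p t d -> continuous p t.
Proof.
  intros H. apply continuous_C_pair.
  - apply (ex_derive_continuous (K := R_AbsRing) (V := R_NormedModule)). eexists. eapply pderiv_Re, H.
  - apply (ex_derive_continuous (K := R_AbsRing) (V := R_NormedModule)). eexists. eapply pderiv_Im, H.
Qed.

Lemma pderiv_comp f p t d e : cderiv f (p t) d -> pderiv p t e ->
  pderiv (fun u => f (p u)) t (d * e)%C.
Proof.
  intros Hf Hp. assert (Cp := pderiv_continuous _ _ _ Hp).
  destruct Hf as [q [Hq [<- Hlq]]]. destruct Hp as [s [Hs [<- Hls]]].
  exists (fun u => q (p u) * s u)%C. split; [|split;auto].
  - apply continuous_Cmult; auto. now apply (continuous_comp p q).
  - specialize (Cp _ Hlq). unfold filtermap in Cp. generalize (filter_and _ _ Cp Hls). apply filter_imp.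
    intros u [h k]. rewrite h, k. ring.
Qed.

Lemma pderiv_scal (c : C) p t d : pderiv p t d -> pderiv (fun u => c * p u)%C t (c * d)%C.
Proof.
  intros [q [Hq [<- Hl]]]. exists (fun u => c * q u)%C. split; [|split;auto].
  apply continuous_Cmult; auto. apply continuous_const.
  revert Hl. apply filter_imp. intros u Hu.
  replace (c * p u - c * p t)%C with (c * (p u - p t))%C by ring. rewrite Hu. ring.
Qed.

Definition circle (r t : R) : C := (r * cos t, r * sin t).

Lemma Cmod_circle r t : 0 <= r -> Cmod (circle r t) = r.
Proof.
  intros Hr. unfold Cmod, circle. simpl fst; simpl snd.
  replace ((r * cos t) ^ 2 + (r * sin t) ^ 2) with (r ^ 2).
  - apply sqrt_pow2, Hr.
  - assert (H := sin2_cos2 t). unfold Rsqr in H. simpl. nra.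
Qed.

Lemma circle_continuous r t : continuous (circle r) t.
Proof.
  apply continuous_C_pair; simpl.
  - apply (continuous_mult (K := R_AbsRing)). apply continuous_const. apply continuous_cos.
  - apply (continuous_mult (K := R_AbsRing)). apply continuous_const. apply continuous_sin.
Qed.

Lemma circle_pderiv r t : pderiv (circle r) t (Ci * circle r t)%C.
Proof.
  apply pderiv_pair; simpl; auto_derive; auto; ring.
Qed.

Lemma circle_2PI r : circle r (2 * PI) = circle r 0.
Proof. unfold circle. now rewrite cos_2PI, sin_2PI, cos_0, sin_0. Qed.

Lemma circle_neq_0 r t : 0 < r -> circle r t <> RtoC 0.
Proof.
  intros Hr E. assert (K := Cmod_circle r t ltac:(lra)). rewrite E, Cmod_0 in K. lra.
Qed.

Lemma circle_minus_neq_0 r t z : Cmod z < r -> (circle r t - z)%C <> RtoC 0.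
Proof.
  intros Hr E. assert (E' : circle r t = z) by (rewrite <- (Cplus_0_r z), <- E; ring).
  assert (K := Cmod_circle r t). rewrite E' in K. assert (H := Cmod_ge_0 z). lra.
Qed.

Lemma kernel_continuous z r t : Cmod z < r ->
  continuous (fun t => (circle r t / (circle r t - z))%C) t.
Proof.
  intros H. apply continuous_Cmult. apply circle_continuous. apply continuous_Cinv.
  apply continuous_Cminus. apply circle_continuous. apply continuous_const.
  now apply circle_minus_neq_0.
Qed.

Lemma ex_RInt_cont (g : R -> R) a b : (forall t, continuous g t) -> ex_RInt g a b.
Proof. intros H. apply (ex_RInt_continuous (V := R_CompleteNormedModule)). auto. Qed.

(** The circle contracted towards [z]: the point [z] at [s = 0], the circle at
    [s = 1]. *)
Definition contour (z : C) (r s t : R) : C := (z + s * (circle r t - z))%C.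

Lemma contour_bound z r s t : 0 <= r ->
  Cmod (contour z r s t) <= Rabs (1 - s) * Cmod z + Rabs s * r.
Proof.
  intros Hr. unfold contour.
  replace (z + s * (circle r t - z))%C with (RtoC (1 - s) * z + RtoC s * circle r t)%C
   by (rewrite RtoC_minus; ring).
  eapply Rle_trans. apply Cmod_triangle. rewrite !Cmod_mult, !Cmod_R, Cmod_circle by auto. lra.
Qed.

(** For [0 < s] the integrand is the [t]-derivative of the periodic function
    [Im (f (contour z r s t)) / s]. *)
Lemma RInt_derivative_0 f z r s :
  (forall t, cderiv f (contour z r s t) (C_derive f (contour z r s t)) /\
     continuous (C_derive f) (contour z r s t)) ->
  0 < s ->
  RInt (fun t => fst (C_derive f (contour z r s t) * circle r t)%C) 0 (2 * PI) = 0.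
Proof.
  intros H Hs. apply is_RInt_unique.
  assert (HP : forall t, pderiv (contour z r s) t (s * (Ci * circle r t))%C).
  { intros t. destruct (pderiv_scal s _ _ _ (circle_pderiv r t)) as [q [h1 [h2 h3]]].
    exists q. split; [auto|split;auto]. revert h3. apply filter_imp. intros u <-.
    unfold contour. ring. }
  set (G := fun t => snd (f (contour z r s t)) / s).
  assert (E0 : G (2 * PI) - G 0 = 0).
  { unfold G, contour. rewrite circle_2PI. ring. }
  rewrite <- E0 at 2.
  apply (is_RInt_derive (V := R_CompleteNormedModule) G).
  - intros t _. unfold G. destruct (H t) as [H1 _].
    assert (K := pderiv_Im _ _ _ (pderiv_comp _ _ _ _ _ H1 (HP t))).
    apply (is_derive_scal _ _ (/ s)) in K.
    replace (fst (C_derive f (contour z r s t) * circle r t)%C) with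
     (/ s * snd (C_derive f (contour z r s t) * (s * (Ci * circle r t)))%C).
    2:{ destruct (C_derive f _) as [a b]. destruct (circle r t) as [c d]. simpl. field. lra. }
    revert K. apply is_derive_ext. intros u. as_R. unfold Rdiv. ring.
  - intros t _. apply continuous_Re. destruct (H t) as [_ H2].
    apply continuous_Cmult. 2: apply circle_continuous.
    apply (continuous_comp (contour z r s) (C_derive f)); auto.
    apply (pderiv_continuous _ _ _ (HP t)).
Qed.

(** The homotopy [s ↦ contour z r s], from the point [z] to the circle of
    radius [r], does not change the integral against the Cauchy kernel: its
    [s]-derivative is the integral of a total [t]-derivative. *)
Lemma Cauchy_formula_Re (f : C -> C) z r rho :
  (forall w, Cmod w < rho -> holo_at f w) -> Cmod z < r < rho ->
  RInt (fun t => fst (f (circle r t) * (circle r t / (circle r t - z)))%C) 0 (2 * PI) =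
  RInt (fun t => fst (f z * (circle r t / (circle r t - z)))%C) 0 (2 * PI).
Proof.
  intros Hf Hr. assert (Hz0 := Cmod_ge_0 z).
  assert (Hnz : forall t, (circle r t - z)%C <> RtoC 0) by (intros; apply circle_minus_neq_0; lra).
  set (k := fun t => (circle r t / (circle r t - z))%C).
  assert (Hk : forall t, continuous k t) by (intros; apply kernel_continuous; lra).
  set (ok := fun s => Rabs (1 - s) * Cmod z + Rabs s * r < rho).
  assert (Hin : forall s t, ok s -> Cmod (contour z r s t) < rho).
  { intros s t Hs. eapply Rle_lt_trans. apply contour_bound. lra. exact Hs. }
  assert (Hc2 : forall s t, continuous (fun x : R * R => contour z r (fst x) (snd x)) (s, t)).
  { intros s t. unfold contour. apply continuous_Cplus. apply continuous_const.
    apply continuous_Cmult.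
    - apply continuous_C_pair; simpl. apply continuous_fst. apply continuous_const.
    - apply continuous_Cminus. 2: apply continuous_const.
      apply (continuous_comp (fun x : R * R => snd x) (circle r)). apply continuous_snd. apply circle_continuous. }
  assert (Hc1 : forall s t, continuous (contour z r s) t).
  { intros s t. apply continuous_Cplus. apply continuous_const.
    apply continuous_Cmult. apply continuous_const.
    apply continuous_Cminus. apply circle_continuous. apply continuous_const. }
  set (Phi := fun s t => fst (f (contour z r s t) * k t)%C).
  set (dPhi := fun s t => fst (C_derive f (contour z r s t) * circle r t)%C).
  assert (Hok : forall s, 0 <= s <= 1 -> locally s ok).
  { intros s Hs.
    assert (Hcont : continuous (fun s => Rabs (1 - s) * Cmod z + Rabs s * r) s).
    { apply (continuous_plus (fun s => Rabs (1 - s) * Cmod z) (fun s => Rabs s * r)).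
      - apply (continuous_mult (K := R_AbsRing) (fun s => Rabs (1 - s)) (fun _ => Cmod z)).
        + apply (continuous_comp (fun s => 1 - s) Rabs).
          apply (continuous_minus (fun _ => 1) (fun s => s)). apply continuous_const. apply continuous_id.
          apply continuous_Rabs.
        + apply continuous_const.
      - apply (continuous_mult (K := R_AbsRing) (fun s => Rabs s) (fun _ => r)).
        apply continuous_Rabs. apply continuous_const. }
    apply (Hcont (fun y => y < rho)). apply (open_lt rho).
    rewrite !Rabs_pos_eq by lra. nra. }
  assert (Hder : forall s t, ok s -> is_derive (fun u => Phi u t) s (dPhi s t)).
  { intros s t Hs. unfold Phi, dPhi.
    destruct (holo_at_C_derive _ _ (Hf _ (Hin s t Hs))) as [h _].
    assert (Hp : pderiv (fun u => contour z r u t) s (circle r t - z)%C).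
    { exists (fun _ => (circle r t - z)%C). split; [apply continuous_const|split;auto].
      apply filter_forall. intros u. change R in u. unfold contour. rewrite RtoC_minus. ring. }
    assert (K := pderiv_Re _ _ _ (pderiv_scal (k t) _ _ _ (pderiv_comp f (fun u => contour z r u t) s _ _ h Hp))).
    replace (C_derive f (contour z r s t) * circle r t)%C with
      (k t * (C_derive f (contour z r s t) * (circle r t - z)))%C.
    2:{ unfold k. field. auto. }
    revert K. apply is_derive_ext. intros u. now rewrite Cmult_comm. }
  assert (HJ : forall s, 0 <= s <= 1 ->
     is_derive (fun s => RInt (fun t => Phi s t) 0 (2 * PI)) s (RInt (fun t => dPhi s t) 0 (2 * PI))).
  { intros s Hs. assert (Hs' := locally_singleton _ _ (Hok s Hs)).
    rewrite (RInt_ext (fun t => dPhi s t) (fun t => Derive (fun u => Phi u t) s)).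
    2:{ intros t _. symmetry. now apply is_derive_unique, Hder. }
    apply is_derive_RInt_param.
    - generalize (Hok s Hs). apply filter_imp. intros u Hu t _. eexists. now apply Hder.
    - intros t _. apply continuity_2d_pt_ext_loc with dPhi.
      + destruct (Hok s Hs) as [d Hd]. exists d. intros u v Hu _. symmetry. apply is_derive_unique, Hder.
        apply Hd. exact Hu.
      + assert (Kc : continuous (fun x : R * R => (C_derive f (contour z r (fst x) (snd x)) * circle r (snd x))%C) (s, t)).
        { apply continuous_Cmult.
          * apply (continuous_comp (fun x : R * R => contour z r (fst x) (snd x)) (C_derive f)). apply Hc2.
            apply (holo_at_C_derive f (contour z r s t)), Hf, Hin, Hs'.
          * apply (continuous_comp (fun x : R * R => snd x) (circle r)). apply continuous_snd. apply circle_continuous. }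
        apply continuous_Re in Kc.
        apply <- continuity_2d_pt_filterlim. exact Kc.
    - generalize (Hok s Hs). apply filter_imp. intros u Hu. apply ex_RInt_cont. intros t.
      apply continuous_Re. apply continuous_Cmult; auto.
      apply (continuous_comp (contour z r u) f); auto. apply holo_at_continuous. apply Hf. now apply Hin. }
  assert (HJ0 : forall s, 0 < s <= 1 -> RInt (fun t => dPhi s t) 0 (2 * PI) = 0).
  { intros s Hs. apply RInt_derivative_0; [|lra]. intros t. apply holo_at_C_derive, Hf, Hin.
    apply (locally_singleton _ _ (Hok s ltac:(lra))). }
  destruct (MVT_gen (fun s => RInt (fun t => Phi s t) 0 (2 * PI)) 0 1 (fun _ => 0)) as [c [_ Hc]].
  - rewrite Rmin_left, Rmax_right by lra. intros s Hs.
    assert (K := HJ s ltac:(lra)). rewrite (HJ0 s ltac:(lra)) in K. exact K.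
  - rewrite Rmin_left, Rmax_right by lra. intros s Hs.
    apply continuity_pt_filterlim.
    apply (ex_derive_continuous (K := R_AbsRing) (V := R_NormedModule) (fun s => RInt (fun t => Phi s t) 0 (2 * PI))).
    eexists. now apply HJ.
  - transitivity (RInt (fun t => Phi 1 t) 0 (2 * PI)); [|transitivity (RInt (fun t => Phi 0 t) 0 (2 * PI))].
    + apply RInt_ext. intros t _. unfold Phi, contour.
      replace (z + 1 * (circle r t - z))%C with (circle r t) by ring. reflexivity.
    + lra.
    + apply RInt_ext. intros t _. unfold Phi, contour.
      replace (z + 0 * (circle r t - z))%C with z by ring. reflexivity.
Qed.

(** The mean over a period; componentwise, so that only real integrals occur. *)
Definition mean (q : R -> C) : C :=
  (RInt (fun t => fst (q t)) 0 (2 * PI) / (2 * PI), RInt (fun t => snd (q t)) 0 (2 * PI) / (2 * PI)).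

Lemma mean_ext p q : (forall t, p t = q t) -> mean p = mean q.
Proof.
  intros H. unfold mean. f_equal; f_equal; apply RInt_ext; intros t _; now rewrite H.
Qed.

Lemma ex_RInt_Re (p : R -> C) : (forall t, continuous p t) -> ex_RInt (fun t => fst (p t)) 0 (2 * PI).
Proof. intros H. apply ex_RInt_cont. intros t. now apply continuous_Re. Qed.

Lemma ex_RInt_Im (p : R -> C) : (forall t, continuous p t) -> ex_RInt (fun t => snd (p t)) 0 (2 * PI).
Proof. intros H. apply ex_RInt_cont. intros t. now apply continuous_Im. Qed.

Lemma mean_plus p q : (forall t, continuous p t) -> (forall t, continuous q t) ->
  mean (fun t => p t + q t)%C = (mean p + mean q)%C.
Proof.
  intros Hp Hq. apply injective_projections; unfold mean; simpl.
  - rewrite (RInt_plus (V := R_CompleteNormedModule) (fun t => fst (p t)) (fun t => fst (q t))) by now apply ex_RInt_Re.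
    unfold plus; simpl. unfold Rdiv. ring.
  - rewrite (RInt_plus (V := R_CompleteNormedModule) (fun t => snd (p t)) (fun t => snd (q t))) by now apply ex_RInt_Im.
    unfold plus; simpl. unfold Rdiv. ring.
Qed.

Lemma mean_scal (c : C) p : (forall t, continuous p t) ->
  mean (fun t => c * p t)%C = (c * mean p)%C.
Proof.
  intros Hp. pose proof (ex_RInt_Re p Hp) as H1. pose proof (ex_RInt_Im p Hp) as H2.
  pose proof (fun l => ex_RInt_scal _ _ _ l H1) as H1'. pose proof (fun l => ex_RInt_scal _ _ _ l H2) as H2'.
  pose proof (fun l => RInt_scal (V := R_CompleteNormedModule) _ _ _ l H1) as S1.
  pose proof (fun l => RInt_scal (V := R_CompleteNormedModule) _ _ _ l H2) as S2.
  apply injective_projections; unfold mean; simpl.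
  - assert (E := RInt_minus (V := R_CompleteNormedModule) _ _ _ _ (H1' (fst c)) (H2' (snd c))).
    rewrite S1, S2 in E.
    etransitivity. apply (f_equal (fun x => x / (2 * PI))). exact E.
    unfold minus, plus, opp, scal; simpl. unfold mult; simpl. unfold Rdiv. ring.
  - assert (E := RInt_plus (V := R_CompleteNormedModule) _ _ _ _ (H2' (fst c)) (H1' (snd c))).
    rewrite S1, S2 in E.
    etransitivity. apply (f_equal (fun x => x / (2 * PI))). exact E.
    unfold minus, plus, opp, scal; simpl. unfold mult; simpl. unfold Rdiv. ring.
Qed.

Lemma mean_conj p : (forall t, continuous p t) -> mean (fun t => Cconj (p t)) = Cconj (mean p).
Proof.
  intros Hp. apply injective_projections; unfold mean; simpl; [reflexivity|].
  rewrite (RInt_opp (V := R_CompleteNormedModule)) by now apply ex_RInt_Im.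
  unfold opp; simpl. unfold Rdiv. ring.
Qed.

Lemma mean_const (c : C) : mean (fun _ => c) = c.
Proof.
  assert (H := PI_RGT_0).
  apply injective_projections; unfold mean; simpl; rewrite RInt_const; unfold scal; simpl; unfold mult; simpl; field; lra.
Qed.

Lemma continuous_Cmod {T : UniformSpace} (p : T -> C) t : continuous p t -> continuous (fun u => Cmod (p u)) t.
Proof.
  intros H. apply (continuous_comp p Cmod); auto.
  exact (filterlim_norm (K := C_AbsRing) (V := C_NormedModule) (p t)).
Qed.

Lemma mean_Re_pos p : (forall t, continuous p t) -> (forall t, 0 <= fst (p t)) -> 0 <= fst (mean p).
Proof.
  intros Hp H. assert (K := PI_RGT_0). unfold mean; simpl. apply Rdiv_le_0_compat; [|lra].
  apply RInt_ge_0; auto. lra. now apply ex_RInt_Re.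
Qed.

Lemma Cmod_mean_le p (g : R -> R) : (forall t, continuous p t) -> (forall t, continuous g t) ->
  (forall t, Cmod (p t) <= g t) -> Cmod (mean p) <= RInt g 0 (2 * PI) / (2 * PI).
Proof.
  intros Hp Hg H. assert (HPI := PI_RGT_0). set (m := mean p).
  destruct (Req_dec (Cmod m) 0) as [E|E].
  { rewrite E. apply Rdiv_le_0_compat; [|lra]. apply RInt_ge_0. lra. now apply ex_RInt_cont.
    intros t _. eapply Rle_trans. apply Cmod_ge_0. apply H. }
  assert (Hm : 0 < Cmod m) by (assert (K := Cmod_ge_0 m); lra).
  (* Rotate so that the mean becomes nonnegative, then compare real parts. *)
  assert (K : fst (mean (fun t => Cconj m * p t)%C) = Cmod m ^ 2).
  { rewrite mean_scal by auto. fold m. rewrite Cmod2_alt. unfold Re, Im, Cconj. simpl. ring. }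
  unfold mean in K; simpl fst in K.
  assert (L : RInt (fun t => fst (Cconj m * p t)%C) 0 (2 * PI) <= Cmod m * RInt g 0 (2 * PI)).
  { rewrite <- (RInt_scal (V := R_CompleteNormedModule) g) by now apply ex_RInt_cont.
    apply RInt_le. lra.
    - apply (ex_RInt_Re (fun t => Cconj m * p t)%C). intros t. apply continuous_Cmult; auto. apply continuous_const.
    - apply (ex_RInt_scal (V := R_NormedModule)). now apply ex_RInt_cont.
    - intros t _. eapply Rle_trans. apply Rle_abs. eapply Rle_trans. apply re_le_Cmod.
      rewrite Cmod_mult, Cmod_conj. apply Rmult_le_compat_l. lra. apply H. }
  apply Rmult_le_reg_l with (Cmod m); auto.
  replace (Cmod m * Cmod m) with (Cmod m ^ 2) by ring. rewrite <- K.
  unfold Rdiv. rewrite <- Rmult_assoc. apply Rmult_le_compat_r; auto.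
  apply Rlt_le, Rinv_0_lt_compat. lra.
Qed.

Lemma on_circle_continuous (f : C -> C) r rho t : (forall w, Cmod w < rho -> holo_at f w) -> 0 <= r < rho ->
  continuous (fun t => f (circle r t)) t.
Proof.
  intros Hf Hr. apply (continuous_comp (circle r) f). apply circle_continuous.
  apply holo_at_continuous, Hf. rewrite Cmod_circle; lra.
Qed.

(** The imaginary part of the formula for [f] is its real part for [- Ci * f]. *)
Lemma Cauchy_formula_kernel (f : C -> C) z r rho :
  (forall w, Cmod w < rho -> holo_at f w) -> Cmod z < r < rho ->
  mean (fun t => f (circle r t) * (circle r t / (circle r t - z)))%C =
  (f z * mean (fun t => circle r t / (circle r t - z)))%C.
Proof.
  intros Hf Hr. rewrite <- mean_scal by (intros; apply kernel_continuous; lra).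
  unfold mean. f_equal; f_equal.
  - exact (Cauchy_formula_Re f z r rho Hf Hr).
  - assert (K := Cauchy_formula_Re (fun w => - Ci * f w)%C z r rho
      (fun w Hw => holo_at_mult _ _ _ (holo_at_const _ _) (Hf w Hw)) Hr).
    etransitivity; [etransitivity; [|exact K]|]; apply RInt_ext; intros t _; as_R; simpl; ring.
Qed.

(** The mean value property: at the centre of the circle the Cauchy kernel is
    the constant [1]. *)
Lemma mean_holo (f : C -> C) r rho :
  (forall w, Cmod w < rho -> holo_at f w) -> 0 < r < rho ->
  mean (fun t => f (circle r t)) = f (RtoC 0).
Proof.
  intros Hf Hr. assert (K := Cauchy_formula_kernel f (RtoC 0) r rho Hf ltac:(rewrite Cmod_0; auto)).
  assert (E : forall t, (circle r t / (circle r t - 0))%C = RtoC 1).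
  { intros t. field. apply circle_neq_0; lra. }
  rewrite (mean_ext (fun t => circle r t / (circle r t - 0))%C (fun _ => RtoC 1)) in K by auto.
  rewrite mean_const, Cmult_1_r in K. rewrite <- K. apply mean_ext. intros t. rewrite E. ring.
Qed.

Lemma Cinv_circle r t : 0 < r -> (/ circle r t)%C = (/ (r ^ 2)%R * Cconj (circle r t))%C.
Proof.
  intros Hr. assert (H := circle_neq_0 r t Hr).
  assert (E := Cmod2_conj (circle r t)). rewrite Cmod_circle in E by lra. rewrite E.
  assert (H' : Cconj (circle r t) <> RtoC 0).
  { intros K. apply H. rewrite <- (Cconj_conj (circle r t)), K. unfold Cconj; simpl. apply injective_projections; simpl; ring. }
  field. auto.
Qed.

(** On the circle [/ w] is a multiple of [Cconj w], so the mean is conjugate to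
    that of [w^n], which the mean value property computes. *)
Lemma mean_circle_neg_pow r n : 0 < r -> (0 < n)%nat -> mean (fun t => / circle r t ^ n)%C = RtoC 0.
Proof.
  intros Hr Hn.
  rewrite (mean_ext _ (fun t => (/ (r ^ 2)%R) ^ n * Cconj (circle r t ^ n))%C).
  2:{ intros t. rewrite <- Cpow_inv by now apply circle_neq_0.
      rewrite Cinv_circle, Cpow_mult_l, Cpow_conj by auto. reflexivity. }
  assert (Hc : forall t, continuous (fun t => circle r t ^ n)%C t)
    by (intros; apply continuous_Cpow, circle_continuous).
  rewrite mean_scal, mean_conj; auto.
  2:{ intros t. apply continuous_C_pair; simpl. now apply (continuous_Re (fun t => circle r t ^ n)%C).
      apply (continuous_opp (fun t => snd (circle r t ^ n)%C)). now apply continuous_Im. }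
  rewrite (mean_holo (fun w => w ^ n)%C r (r + 1)) by (lra || (intros; apply holo_at_pow, holo_at_id)).
  destruct n as [|n]; [lia|]. simpl. rewrite Cmult_0_l. unfold Cconj. simpl.
  replace (0, -0) with (RtoC 0) by (unfold RtoC; f_equal; ring). ring.
Qed.

Lemma is_series_C_eps (a : nat -> C) (l : C) :
  (forall eps, 0 < eps -> exists N, forall n, (N <= n)%nat ->
     Cmod (sum_n (G := C_AbelianMonoid) a n - l)%C < eps) ->
  is_series (V := C_NormedModule) a l.
Proof.
  intros H P HP. apply (locally_Cmod l P) in HP. destruct HP as [d [Hd HP]].
  destruct (H d Hd) as [N HN]. exists N. intros n Hn. apply HP. now apply HN.
Qed.

(** * Taylor series *)

Definition const_coeffs (c : C) (n : nat) : C := match n with O => c | S _ => RtoC 0 end.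

Lemma is_pseries_const (c z : C) : is_pseries (const_coeffs c) z c.
Proof.
  apply is_pseries_C. apply is_series_C_eps. intros eps He. exists 0%nat. intros n _.
  assert (E : sum_n (G := C_AbelianMonoid) (fun n => const_coeffs c n * z ^ n)%C n = c).
  { induction n as [|n IH]. rewrite sum_O. as_C. simpl. ring.
    rewrite sum_Sn, IH. unfold plus; simpl. as_C. ring. }
  rewrite E. replace (c - c)%C with (RtoC 0) by ring. now rewrite Cmod_0.
Qed.

(** Expansion of the Cauchy kernel in powers of [z / circle r t].  The error of
    the partial sum of index [N] is [z^(N+1)] times a mean of size
    [r^-(N+1)]. *)
Lemma kernel_series (q : R -> C) z r : (forall t, continuous q t) -> Cmod z < r ->
  is_pseries (fun n => mean (fun t => q t / circle r t ^ n)%C) z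
    (mean (fun t => q t * (circle r t / (circle r t - z)))%C).
Proof.
  intros Hq Hz. assert (Hz0 := Cmod_ge_0 z).
  set (k := fun t => (circle r t / (circle r t - z))%C).
  assert (Hk : forall t, continuous (fun t => q t * k t)%C t).
  { intros t. apply continuous_Cmult; auto. now apply kernel_continuous. }
  assert (Hk' : forall n t, continuous (fun t => q t * k t / circle r t ^ n)%C t).
  { intros n t. apply continuous_Cmult; auto. apply continuous_Cinv. apply continuous_Cpow, circle_continuous.
    apply Cpow_nz, circle_neq_0. lra. }
  assert (Estep : forall n, mean (fun t => q t / circle r t ^ n)%C =
     (mean (fun t => q t * k t / circle r t ^ n) - z * mean (fun t => q t * k t / circle r t ^ S n))%C).
  { intros n. replace (mean (fun t => q t * k t / circle r t ^ n) - z * mean (fun t => q t * k t / circle r t ^ S n))%C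
     with (mean (fun t => q t * k t / circle r t ^ n) + (- z) * mean (fun t => q t * k t / circle r t ^ S n))%C by ring.
    rewrite <- mean_scal by auto. rewrite <- mean_plus; auto.
    2:{ intros t. apply continuous_Cmult; auto. apply continuous_const. }
    apply mean_ext. intros t. unfold k. simpl. field. split. now apply circle_minus_neq_0.
    split. apply Cpow_nz. all: apply circle_neq_0; lra. }
  assert (Esum : forall N, (sum_n (G := C_AbelianMonoid) (fun n => mean (fun t => q t / circle r t ^ n) * z ^ n)%C N
     - mean (fun t => q t * k t))%C = (- (z ^ S N * mean (fun t => q t * k t / circle r t ^ S N)))%C).
  { induction N as [|N IH].
    - rewrite sum_O. rewrite (Estep 0%nat).
      rewrite (mean_ext (fun t => q t * k t / circle r t ^ 0)%C (fun t => q t * k t)%C).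
      2:{ intros t. simpl. field. }
      simpl. ring.
    - rewrite sum_Sn.
      match goal with |- (plus ?a ?b - ?c)%C = _ => transitivity ((a - c) + b)%C;
        [change (plus a b) with (a + b)%C; ring|] end.
      rewrite IH, (Estep (S N)). simpl Cpow. ring. }
  apply is_pseries_C. apply is_series_C_eps. intros eps He.
  set (M := RInt (fun t => Cmod (q t * k t)%C) 0 (2 * PI) / (2 * PI)).
  assert (HB : forall N, Cmod (z ^ N * mean (fun t => q t * k t / circle r t ^ N))%C <= (Cmod z / r) ^ N * M).
  { intros N. rewrite <- mean_scal by auto.
    assert (HPI := PI_RGT_0).
    replace ((Cmod z / r) ^ N * M) with (RInt (fun t => (Cmod z / r) ^ N * Cmod (q t * k t)%C) 0 (2 * PI) / (2 * PI)).
    2:{ rewrite (RInt_scal (V := R_CompleteNormedModule)).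
        unfold M, scal; simpl. unfold mult; simpl. unfold Rdiv. ring.
        apply ex_RInt_cont. intros t. now apply continuous_Cmod. }
    apply Cmod_mean_le.
    - intros t. apply continuous_Cmult; auto. apply continuous_const.
    - intros t. apply (continuous_mult (K := R_AbsRing)). apply continuous_const. now apply continuous_Cmod.
    - intros t. apply Req_le.
      replace (z ^ N * (q t * k t / circle r t ^ N))%C with ((z / circle r t) ^ N * (q t * k t))%C.
      + rewrite Cmod_mult, Cmod_pow, Cmod_div, Cmod_circle. reflexivity. lra. apply circle_neq_0; lra.
      + unfold Cdiv at 1. rewrite Cpow_mult_l, Cpow_inv by (apply circle_neq_0; lra).
        field. apply Cpow_nz, circle_neq_0. lra. }
  assert (Hx : Rabs (Cmod z / r) < 1).
  { rewrite Rabs_pos_eq. apply Rmult_lt_reg_r with r. lra. unfold Rdiv. rewrite Rmult_assoc, Rinv_l; lra.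
    apply Rdiv_le_0_compat; lra. }
  assert (HM := Rabs_pos M).
  destruct (pow_lt_1_zero _ Hx (eps / (Rabs M + 1))) as [N HN]. apply Rdiv_lt_0_compat; lra.
  exists N. intros n Hn. fold k. rewrite Esum, Cmod_opp. eapply Rle_lt_trans. apply HB.
  specialize (HN (S n) ltac:(lia)).
  eapply Rle_lt_trans. apply Rle_abs. rewrite Rabs_mult.
  apply Rle_lt_trans with (Rabs ((Cmod z / r) ^ S n) * (Rabs M + 1)).
  apply Rmult_le_compat_l. apply Rabs_pos. lra.
  apply Rmult_lt_reg_r with (/ (Rabs M + 1)). apply Rinv_0_lt_compat; lra.
  rewrite Rmult_assoc, Rinv_r by lra. unfold Rdiv in HN. lra.
Qed.

(** All the terms of the expansion have mean [0] except the first. *)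
Lemma mean_kernel z r : Cmod z < r -> mean (fun t => circle r t / (circle r t - z))%C = RtoC 1.
Proof.
  intros Hz. assert (Hz0 := Cmod_ge_0 z).
  assert (K := kernel_series (fun _ => RtoC 1) z r (fun t => continuous_const _ _) Hz).
  rewrite (mean_ext _ (fun t => circle r t / (circle r t - z))%C) in K.
  2:{ intros t. ring. }
  assert (L := is_pseries_const (RtoC 1) z).
  apply (proj1 (is_pseries_C _ _ _)) in K. apply (proj1 (is_pseries_C _ _ _)) in L.
  apply (is_series_C_unique _ _ _ K). revert L. apply is_series_ext. intros n. as_C. f_equal.
  destruct n as [|n]; unfold const_coeffs.
  - rewrite (mean_ext _ (fun _ => RtoC 1)). now rewrite mean_const. intros t. simpl. field.
  - rewrite (mean_ext _ (fun t => / circle r t ^ S n)%C). rewrite mean_circle_neg_pow; auto. lra. lia.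
    intros t. unfold Cdiv. ring.
Qed.

Lemma Taylor_circle (f : C -> C) r rho :
  (forall w, Cmod w < rho -> holo_at f w) -> 0 < r < rho -> forall z, Cmod z < r ->
  is_pseries (fun n => mean (fun t => f (circle r t) / circle r t ^ n)%C) z (f z).
Proof.
  intros Hf Hr z Hz.
  assert (K := kernel_series (fun t => f (circle r t)) z r
     (fun t => on_circle_continuous f r rho t Hf ltac:(lra)) Hz).
  cbv beta in K.
  rewrite (Cauchy_formula_kernel f z r rho Hf) in K by lra.
  rewrite mean_kernel, Cmult_1_r in K by auto. exact K.
Qed.

(** * Uniqueness of coefficients and the identity theorem *)

Lemma Rle_0_of_small x M d : 0 < d -> (forall t, 0 < t < d -> x <= M * t) -> x <= 0.
Proof.
  intros Hd H. destruct (Rle_lt_dec x 0) as [h|h]; auto. exfalso.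
  assert (HM := Rabs_pos M). assert (HM2 := Rle_abs M).
  set (t := Rmin (d / 2) (x / (2 * (Rabs M + 1)))).
  assert (Hx : 0 < x / (2 * (Rabs M + 1))) by (apply Rdiv_lt_0_compat; lra).
  assert (Ht : 0 < t) by (apply Rmin_pos; lra).
  assert (t <= d / 2) by apply Rmin_l.
  assert (Ht2 : t <= x / (2 * (Rabs M + 1))) by apply Rmin_r.
  specialize (H t ltac:(lra)).
  apply (Rmult_le_compat_l (2 * (Rabs M + 1))) in Ht2; [|lra].
  replace (2 * (Rabs M + 1) * (x / (2 * (Rabs M + 1)))) with x in Ht2 by (field; lra). nra.
Qed.

(** Each division by [z] lowers by one the order of vanishing and the index of
    the coefficients.  Only points other than [0] are constrained, since the
    bound on [F z / z] says nothing at [0]. *)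
Lemma coeffs_vanish K : forall (A : nat -> C) (F : C -> C) (rho M delta : R), 0 < rho -> 0 < delta ->
  (forall z, Cmod z < rho -> is_pseries A z (F z)) ->
  (forall z, 0 < Cmod z < delta -> Cmod (F z) <= M * Cmod z ^ K) ->
  forall k, (k < K)%nat -> A k = RtoC 0.
Proof.
  induction K as [|K IH]; intros A F rho M delta Hr Hd HA HF k Hk. lia.
  assert (A0 : A 0%nat = RtoC 0).
  { destruct (pseries_tail A F rho (rho / 2) 0 HA ltac:(lra)) as [M' HM'].
    apply Cmod_eq_0. apply Rle_antisym; [|apply Cmod_ge_0].
    apply Rle_0_of_small with (M := Rabs M + M') (d := Rmin 1 (Rmin (rho / 2) delta)).
    { repeat apply Rmin_pos; lra. }
    intros t Ht.
    assert (t1 := Rmin_l 1 (Rmin (rho / 2) delta)). assert (t2 := Rmin_r 1 (Rmin (rho / 2) delta)).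
    assert (t3 := Rmin_l (rho / 2) delta). assert (t4 := Rmin_r (rho / 2) delta).
    assert (Et : Cmod t = t) by (rewrite Cmod_R, Rabs_pos_eq; lra).
    specialize (HM' t ltac:(lra)). specialize (HF t ltac:(lra)). rewrite Et in *.
    rewrite sum_O in HM'.
    replace (A 0%nat) with (F t - (F t - A 0%nat * t ^ 0))%C by (simpl; ring).
    eapply Rle_trans. apply Cmod_triangle. rewrite Cmod_opp.
    assert (Hp : t ^ S K <= t).
    { apply Rle_trans with (t * 1); [|lra]. apply Rmult_le_compat_l. lra.
      assert (Hp := pow_incr t 1 K ltac:(lra)). now rewrite pow1 in Hp. }
    assert (Hp0 : 0 <= t ^ S K) by (apply pow_le; lra).
    assert (H1 : M * t ^ S K <= Rabs M * t).
    { eapply Rle_trans. apply Rmult_le_compat_r; [auto|apply Rle_abs].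
      apply Rmult_le_compat_l; auto. apply Rabs_pos. }
    rewrite pow_1 in HM'. lra. }
  destruct k as [|k]; auto.
  apply (IH (fun n => A (S n)) (shift_fun A F) rho M (Rmin rho delta)); auto; try lia.
  { now apply Rmin_pos. }
  { now apply shift_fun_pseries. }
  intros z Hz. assert (z1 := Rmin_l rho delta). assert (z2 := Rmin_r rho delta).
  assert (E := shift_fun_eq A F rho HA z ltac:(lra)). rewrite A0, Cplus_0_l in E.
  specialize (HF z ltac:(lra)). rewrite E, Cmod_mult in HF.
  apply Rmult_le_reg_l with (Cmod z); [lra|]. simpl in HF. lra.
Qed.

Lemma pseries_coeffs_unique (A B : nat -> C) (F : C -> C) rho : 0 < rho ->
  (forall z, Cmod z < rho -> is_pseries A z (F z)) ->
  (forall z, Cmod z < rho -> is_pseries B z (F z)) -> forall n, A n = B n.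
Proof.
  intros Hr HA HB n. apply Ceq_minus.
  apply (coeffs_vanish (S n) (fun n => A n - B n)%C (fun _ => RtoC 0) rho 0 rho); auto.
  - intros z Hz.
    assert (K := is_pseries_minus (K := C_AbsRing) (V := C_NormedModule) A B z _ _ (HA z Hz) (HB z Hz)).
    replace (RtoC 0) with (plus (F z) (opp (F z)) : C). exact K. apply Cplus_opp_r.
  - intros z _. rewrite Cmod_0. lra.
Qed.

(** By uniqueness the coefficients computed on the circle of radius [rho / 2]
    are those of any larger circle, hence the series converges up to [rho]. *)
Lemma Taylor_ball_0 (f : C -> C) rho : 0 < rho ->
  (forall w, Cmod w < rho -> holo_at f w) ->
  exists A : nat -> C, forall z, Cmod z < rho -> is_pseries A z (f z).
Proof.
  intros Hr Hf. exists (fun n => mean (fun t => f (circle (rho / 2) t) / circle (rho / 2) t ^ n)%C).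
  intros z Hz. assert (Hz0 := Cmod_ge_0 z).
  set (r := Rmax (rho / 2) ((Cmod z + rho) / 2)).
  assert (r1 := Rmax_l (rho / 2) ((Cmod z + rho) / 2)). assert (r2 := Rmax_r (rho / 2) ((Cmod z + rho) / 2)).
  assert (r3 : r < rho) by (apply Rmax_lub_lt; lra). fold r in r1, r2.
  assert (T := Taylor_circle f r rho Hf ltac:(lra)).
  eapply is_pseries_ext. 2: apply T; lra.
  apply (pseries_coeffs_unique _ _ f (rho / 2)); try lra.
  - intros w Hw. apply T. lra.
  - intros w Hw. apply (Taylor_circle f (rho / 2) rho Hf); lra.
Qed.

Lemma holo_at_translate f z0 u : holo_at f (z0 + u)%C -> holo_at (fun w => f (z0 + w)%C) u.
Proof.
  intros [df H]. exists (fun w => df (z0 + w)%C).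
  apply locally_Cmod in H. destruct H as [d [Hd H]]. apply locally_Cmod. exists d. split; auto.
  intros w Hw. destruct (H (z0 + w)%C) as [h1 h2].
  { replace (z0 + w - (z0 + u))%C with (w - u)%C by ring. auto. }
  split.
  - apply cderiv_translate with (- z0)%C.
    replace (w - - z0)%C with (z0 + w)%C by ring.
    revert h1. apply cderiv_ext_loc. apply filter_forall. intros v. change C in v. as_C. f_equal. ring.
  - apply (continuous_comp (fun w => z0 + w)%C df); auto.
    apply continuous_Cplus. apply continuous_const. apply continuous_id.
Qed.

Lemma Taylor_ball (f : C -> C) z0 rho : 0 < rho ->
  (forall w, Cmod (w - z0) < rho -> holo_at f w) ->
  exists A : nat -> C, forall u, Cmod u < rho -> is_pseries A u (f (z0 + u)%C).
Proof.
  intros Hr Hf. apply (Taylor_ball_0 (fun u => f (z0 + u)%C) rho Hr).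
  intros u Hu. apply holo_at_translate, Hf. now replace (z0 + u - z0)%C with u by ring.
Qed.

Lemma disk_ball z w : Cmod (w - z) < 1 - Cmod z -> in_disk w.
Proof.
  intros H. unfold in_disk. replace w with ((w - z) + z)%C by ring.
  eapply Rle_lt_trans. apply Cmod_triangle. lra.
Qed.

Lemma holo_on_disk_analytic (f : C -> C) :
  (forall z, in_disk z -> holo_at f z) -> analytic_on_disk f.
Proof.
  intros Hf z0 Hz0. assert (Hp : 0 < 1 - Cmod z0) by (unfold in_disk in Hz0; lra).
  destruct (Taylor_ball f z0 (1 - Cmod z0) Hp) as [A HA].
  { intros w Hw. apply Hf. now apply disk_ball in Hw. }
  exists A, (1 - Cmod z0). split; auto. intros z Hz. specialize (HA (z - z0)%C Hz).
  now replace (z0 + (z - z0))%C with z in HA by ring.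
Qed.

Lemma holo_on_disk_expansion (f : C -> C) :
  (forall z, in_disk z -> holo_at f z) -> exists A : nat -> C, has_expansion f A.
Proof. intros H. apply Taylor_ball_0. lra. exact H. Qed.

Lemma expansion_holo f A z : has_expansion f A -> in_disk z -> holo_at f z.
Proof.
  intros H Hz. apply (holo_at_pseries A f (RtoC 0) 1).
  - intros w Hw. replace (w - 0)%C with w in * by ring. now apply H.
  - now replace (z - 0)%C with z by ring.
Qed.

Lemma zero_near_zero_on_ball (f : C -> C) z0 rho :
  (forall w, Cmod (w - z0) < rho -> holo_at f w) ->
  locally z0 (fun w => f w = RtoC 0) -> forall w, Cmod (w - z0) < rho -> f w = RtoC 0.
Proof.
  intros Hf H0 w Hw. assert (Hr := Rle_lt_trans _ _ _ (Cmod_ge_0 _) Hw).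
  destruct (Taylor_ball f z0 rho Hr Hf) as [A HA].
  apply locally_Cmod in H0. destruct H0 as [d [Hd H0]].
  assert (HA0 : forall n, A n = RtoC 0).
  { intros n. apply (coeffs_vanish (S n) A (fun u => f (z0 + u)%C) rho 0 d); auto.
    intros z Hz. rewrite H0. rewrite Cmod_0; lra. replace (z0 + z - z0)%C with z by ring. lra. }
  specialize (HA (w - z0)%C Hw). replace (z0 + (w - z0))%C with w in HA by ring.
  apply (proj1 (is_pseries_C _ _ _)) in HA.
  apply (is_series_C_unique _ _ _ HA).
  generalize (proj1 (is_pseries_C _ _ _) (is_pseries_const (RtoC 0) (w - z0)%C)).
  apply is_series_ext. intros n. rewrite HA0. now destruct n.
Qed.

(** A zero set with an interior point propagates along the
    radius, in steps of a fixed length, to a neighbourhood of [0], and from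
    there to the whole disk. *)
Lemma identity_theorem (f : C -> C) z0 : (forall z, in_disk z -> holo_at f z) -> in_disk z0 ->
  locally z0 (fun w => f w = RtoC 0) -> forall w, in_disk w -> f w = RtoC 0.
Proof.
  intros Hf Hz0 H0.
  assert (Hball : forall z w : C, locally z (fun w => f w = RtoC 0) -> Cmod (w - z) < 1 - Cmod z -> f w = RtoC 0).
  { intros z w Hz. apply (zero_near_zero_on_ball f z (1 - Cmod z)); auto.
    intros v Hv. apply Hf. now apply disk_ball in Hv. }
  assert (Hball' : forall z w : C, locally z (fun w => f w = RtoC 0) -> Cmod (w - z) < 1 - Cmod z ->
     locally w (fun w => f w = RtoC 0)).
  { intros z w Hz Hw. apply locally_Cmod. exists (1 - Cmod z - Cmod (w - z)). split. lra.
    intros v Hv. apply (Hball z v Hz). replace (v - z)%C with ((v - w) + (w - z))%C by ring.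
    eapply Rle_lt_trans. apply Cmod_triangle. lra. }
  set (d := (1 - Cmod z0) / 2). unfold in_disk in Hz0.
  assert (Hd : 0 < d) by (unfold d; lra).
  assert (Hind : forall n z, Cmod z <= INR n * d -> 2 * d <= 1 - Cmod z ->
     locally z (fun w => f w = RtoC 0) -> locally (RtoC 0) (fun w => f w = RtoC 0)).
  { induction n as [|n IH]; intros z Hn Hz Hl.
    - simpl in Hn. rewrite Rmult_0_l in Hn. assert (E : z = RtoC 0).
      { apply Cmod_eq_0, Rle_antisym; auto. apply Cmod_ge_0. }
      now rewrite E in Hl.
    - destruct (Rle_lt_dec (Cmod z) d) as [h|h].
      + apply (Hball' z); auto. replace (0 - z)%C with (- z)%C by ring. rewrite Cmod_opp. lra.
      + assert (Ez : Cmod (z * (1 - d / Cmod z)%R)%C = Cmod z - d).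
        { rewrite Cmod_mult, Cmod_R, Rabs_pos_eq. field. lra.
          assert (d / Cmod z < 1). apply Rmult_lt_reg_r with (Cmod z). lra.
          unfold Rdiv. rewrite Rmult_assoc, Rinv_l; lra. lra. }
        apply (IH (z * (1 - d / Cmod z)%R)%C).
        * rewrite Ez. rewrite S_INR in Hn. lra.
        * rewrite Ez. lra.
        * apply (Hball' z); auto.
          replace (z * (1 - d / Cmod z)%R - z)%C with (- (z * (d / Cmod z)%R))%C by (rewrite RtoC_minus; ring).
          rewrite Cmod_opp, Cmod_mult, Cmod_R, Rabs_pos_eq.
          replace (Cmod z * (d / Cmod z)) with d by (field; lra). lra.
          apply Rdiv_le_0_compat; lra. }
  assert (Hd1 : d <= 1) by (assert (K := Cmod_ge_0 z0); unfold d; lra).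
  assert (H00 : locally (RtoC 0) (fun w => f w = RtoC 0)).
  { destruct (nfloor_ex (Cmod z0 / d)) as [n Hn]. apply Rdiv_le_0_compat; auto. apply Cmod_ge_0.
    apply (Hind (S n) z0); auto. 2: unfold d; lra.
    rewrite S_INR. apply Rmult_le_reg_r with (/ d). now apply Rinv_0_lt_compat.
    rewrite Rmult_assoc, Rinv_r by lra. unfold Rdiv in Hn. lra. }
  intros w Hw. apply (Hball (RtoC 0)); auto.
  replace (w - 0)%C with w by ring. rewrite Cmod_0, Rminus_0_r. exact Hw.
Qed.

(** * Coefficient bounds *)

Lemma exists_rotation (c : C) : exists mu : C, Cmod mu = 1 /\ (mu * c)%C = RtoC (Cmod c).
Proof.
  destruct (Ceq_dec c (RtoC 0)) as [->|h].
  - exists (RtoC 1). rewrite Cmod_1, Cmod_0. split; auto. ring.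
  - assert (hp := proj1 (Cmod_gt_0 c) h).
    assert (h' : RtoC (Cmod c) <> RtoC 0) by (intros K; apply RtoC_inj in K; lra).
    exists (Cconj c / Cmod c)%C. split.
    + rewrite Cmod_div, Cmod_conj, Cmod_R, Rabs_pos_eq by (auto; lra). field. lra.
    + replace (Cconj c / Cmod c * c)%C with (c * Cconj c / Cmod c)%C by (field; auto).
      rewrite <- Cmod2_conj, <- RtoC_div by lra. f_equal. field. lra.
Qed.

(** The weight [2 + 2 Re (mu (r/w)^j)] is nonnegative, and the
    mean of [P] against it only sees the coefficients [0] and [j]. *)
Lemma Caratheodory_coeff (P : C -> C) (p : nat -> C) rho r j :
  (forall z, Cmod z < rho -> is_pseries p z (P z)) -> 0 < r < rho ->
  (forall t, 0 <= fst (P (circle r t))) -> (0 < j)%nat ->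
  Cmod (p j) * r ^ j <= 2 * fst (p 0%nat).
Proof.
  intros HP Hr Hpos Hj.
  assert (Hh : forall w, Cmod w < rho -> holo_at P w).
  { intros w Hw. apply (holo_at_pseries p P (RtoC 0) rho).
    - intros v Hv. replace (v - 0)%C with v in * by ring. auto.
    - now replace (w - 0)%C with w by ring. }
  assert (Hp : forall n, mean (fun t => P (circle r t) / circle r t ^ n)%C = p n).
  { apply (pseries_coeffs_unique _ p P r). lra.
    - apply (Taylor_circle P r rho Hh). lra.
    - intros z Hz. apply HP. lra. }
  assert (Hm : mean (fun t => P (circle r t) * circle r t ^ j)%C = RtoC 0).
  { rewrite (mean_holo (fun w => P w * w ^ j)%C r rho); auto.
    - destruct j; [lia|]. simpl. ring.
    - intros w Hw. apply holo_at_mult; auto. apply holo_at_pow, holo_at_id. }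
  destruct (exists_rotation (p j)) as [nu [Hnu1 Hnu2]]. set (mu := (- nu)%C).
  assert (Hmu : Cmod mu = 1) by (unfold mu; now rewrite Cmod_opp).
  assert (C1 : forall t, continuous (fun t => P (circle r t)) t).
  { intros t. apply on_circle_continuous with rho; auto. lra. }
  assert (C2 : forall n t, continuous (fun t => circle r t ^ n)%C t).
  { intros n t. apply continuous_Cpow, circle_continuous. }
  assert (C3 : forall n t, continuous (fun t => / circle r t ^ n)%C t).
  { intros n t. apply continuous_Cinv; auto. apply Cpow_nz, circle_neq_0. lra. }
  assert (Hrj : 0 < r ^ j) by (apply pow_lt; lra).
  set (a := (mu * RtoC (r ^ j))%C). set (b := (Cconj mu * RtoC (/ r ^ j))%C).
  set (W := fun t : R => (RtoC 2 * (P (circle r t) / circle r t ^ 0) + (a * (P (circle r t) / circle r t ^ j)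
      + b * (P (circle r t) * circle r t ^ j)))%C).
  assert (D1 : forall n t, continuous (fun t => P (circle r t) / circle r t ^ n)%C t).
  { intros n t. apply continuous_Cmult; auto. }
  assert (D2 : forall t, continuous (fun t => P (circle r t) * circle r t ^ j)%C t).
  { intros t. apply continuous_Cmult; auto. }
  assert (D3 : forall (c : C) (q : R -> C), (forall t, continuous q t) -> forall t, continuous (fun t => c * q t)%C t).
  { intros c q Hq t. apply continuous_Cmult; auto. apply continuous_const. }
  assert (D4 := fun n c => D3 c _ (D1 n)). assert (D5 := fun c => D3 c _ D2).
  assert (D6 : forall t, continuous (fun t => a * (P (circle r t) / circle r t ^ j)
      + b * (P (circle r t) * circle r t ^ j))%C t).
  { intros t. apply continuous_Cplus; auto. }
  assert (E : mean W = (2 * p 0%nat + (a * p j + b * 0))%C).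
  { unfold W. rewrite !mean_plus, !mean_scal, !Hp, Hm; auto. }
  assert (Ew : forall t, exists x, 0 <= x /\ W t = (RtoC x * P (circle r t))%C).
  { intros t. set (v := (mu * (RtoC (r ^ j) / circle r t ^ j))%C).
    assert (Hv : Cmod v = 1).
    { unfold v. rewrite Cmod_mult, Cmod_div, Cmod_pow, Cmod_circle, Cmod_R, Rabs_pos_eq, Hmu.
      field. all: try lra. apply Cpow_nz, circle_neq_0. lra. }
    assert (Ev : (Cconj mu * (RtoC (/ r ^ j) * circle r t ^ j) = Cconj v)%C).
    { unfold v. rewrite Cmult_conj. f_equal.
      assert (Hc : (circle r t ^ j)%C <> RtoC 0) by (apply Cpow_nz, circle_neq_0; lra).
      rewrite Cdiv_conj by auto.
      assert (K := Cmod2_conj (circle r t ^ j)). rewrite Cmod_pow, Cmod_circle in K by lra.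
      replace (Cconj (RtoC (r ^ j))) with (RtoC (r ^ j)) by (unfold Cconj, RtoC; simpl; f_equal; ring).
      assert (Hc' : Cconj (circle r t ^ j) <> RtoC 0).
      { intros Z. rewrite Z, Cmult_0_r in K. apply RtoC_inj in K. assert (0 < (r ^ j) ^ 2) by (apply pow_lt; auto). lra. }
      assert (Hr' : RtoC (r ^ j) <> RtoC 0) by (intros Z; apply RtoC_inj in Z; lra).
      rewrite RtoC_inv by lra.
      replace ((r ^ j) ^ 2) with (r ^ j * r ^ j) in K by ring. rewrite RtoC_mult in K.
      apply (f_equal (fun x => x / (RtoC (r ^ j) * Cconj (circle r t ^ j)))%C) in K.
      transitivity ((circle r t ^ j * Cconj (circle r t ^ j)) / (RtoC (r ^ j) * Cconj (circle r t ^ j)))%C.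
      field; auto. rewrite <- K. field; auto. }
    exists (2 + 2 * fst v). split.
    - assert (K := re_le_Cmod v). rewrite Hv in K. unfold Re in K. apply Rabs_le_between in K. lra.
    - transitivity ((2 + (v + Cconj v)) * P (circle r t))%C.
      + rewrite <- Ev. unfold W, a, b, v. simpl (_ ^ 0)%C. field. apply Cpow_nz, circle_neq_0. lra.
      + f_equal. apply injective_projections; simpl; ring. }
  assert (Hpos2 := mean_Re_pos W). rewrite E in Hpos2.
  assert (F : (a * p j)%C = RtoC (- (Cmod (p j) * r ^ j))).
  { unfold a, mu. replace (- nu * RtoC (r ^ j) * p j)%C with (- (nu * p j) * RtoC (r ^ j))%C by ring.
    rewrite Hnu2, <- RtoC_opp, <- RtoC_mult. f_equal. ring. }
  rewrite F in Hpos2.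
  assert (0 <= fst (2 * p 0%nat + (RtoC (- (Cmod (p j) * r ^ j)) + b * 0))%C).
  { apply Hpos2.
    - intros t. unfold W. apply continuous_Cplus; auto.
    - intros t. destruct (Ew t) as [x [Hx ->]]. rewrite (re_scal_l x). apply Rmult_le_pos; auto. }
  simpl in H. lra.
Qed.

Lemma le_at_1 (x y : R) (m n : nat) :
  (forall r, 0 < r < 1 -> x * r ^ m + y * r ^ n <= 2) -> x + y <= 2.
Proof.
  intros H.
  assert (Hl : is_lim_seq (fun k => x * (1 - / (INR k + 2)) ^ m + y * (1 - / (INR k + 2)) ^ n) (x + y)).
  { assert (L : is_lim_seq (fun k => 1 - / (INR k + 2)) 1).
    { replace (Finite 1) with (Finite (1 - 0)) by (f_equal; ring).
      apply (is_lim_seq_minus' (fun _ => 1) (fun k => / (INR k + 2)) 1 0). apply is_lim_seq_const.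
      replace (Finite 0) with (Rbar_inv p_infty) by reflexivity.
      apply is_lim_seq_inv; [|discriminate].
      apply (is_lim_seq_plus INR (fun _ => 2) p_infty 2). apply is_lim_seq_INR. apply is_lim_seq_const. reflexivity. }
    assert (LP : forall e, is_lim_seq (fun k => (1 - / (INR k + 2)) ^ e) 1).
    { induction e as [|e IH]; simpl. apply is_lim_seq_const.
      replace (Finite 1) with (Finite (1 * 1)) by (f_equal; ring).
      exact (is_lim_seq_mult' _ _ 1 1 L IH). }
    replace (x + y) with (x * 1 + y * 1) by ring.
    apply (is_lim_seq_plus' _ _ (x * 1) (y * 1)).
    exact (is_lim_seq_scal_l _ x (Finite 1) (LP m)). exact (is_lim_seq_scal_l _ y (Finite 1) (LP n)). }
  refine (is_lim_seq_le _ _ (x + y) 2 _ Hl (is_lim_seq_const 2)).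
  intros k. apply H. assert (K := pos_INR k).
  assert (0 < / (INR k + 2)) by (apply Rinv_0_lt_compat; lra).
  assert (/ (INR k + 2) < 1). { rewrite <- Rinv_1. apply Rinv_lt_contravar; lra. }
  lra.
Qed.

(** Write [u = z^n G] and let [la] rotate [G 0] to [Cmod (G 0)].  On the circle
    of radius [r], [Cmod G] is at most [r^-n], so Carathéodory's inequality
    applies to [r^-n - la G]; then [r] tends to [1]. *)
Lemma bounded_coeff (u : C -> C) (A : nat -> C) n j :
  has_expansion u A -> (forall z, in_disk z -> Cmod (u z) <= 1) ->
  (forall k, (k < n)%nat -> A k = RtoC 0) -> (0 < j)%nat ->
  Cmod (A (n + j)%nat) <= 2 * (1 - Cmod (A n)).
Proof.
  intros HA Hu H0 Hj.
  destruct (pseries_factor A u 1 n HA H0) as [G [HG1 HG]].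
  destruct (exists_rotation (A n)) as [la [Hla1 Hla2]].
  assert (Hr : forall r, 0 < r < 1 -> Cmod (A (n + j)%nat) * r ^ (n + j) + 2 * Cmod (A n) * r ^ n <= 2).
  { intros r Hr. assert (Hrn : 0 < r ^ n) by (apply pow_lt; lra).
    assert (K := Caratheodory_coeff (fun z => RtoC (/ r ^ n) + (- la) * G z)%C
      (fun k => const_coeffs (RtoC (/ r ^ n)) k + (- la) * A (n + k)%nat)%C 1 r j).
    cbv beta in K. destruct j as [|i]; [lia|]. simpl const_coeffs in K.
    replace (0 + - la * A (n + S i)%nat)%C with (- (la * A (n + S i)%nat))%C in K by ring.
    rewrite Cmod_opp, Cmod_mult, Hla1, Nat.add_0_r in K.
    replace (RtoC (/ r ^ n) + - la * A n)%C with (RtoC (/ r ^ n - Cmod (A n))) in K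
      by (rewrite RtoC_minus, <- Hla2; ring).
    simpl fst in K.
    assert (K' : 1 * Cmod (A (n + S i)%nat) * r ^ S i <= 2 * (/ r ^ n - Cmod (A n))).
    { apply K; auto; try lia.
      - intros z Hz.
        apply (is_pseries_plus (K := C_AbsRing) (V := C_NormedModule)). apply is_pseries_const.
        apply (is_pseries_scal (K := C_AbsRing) (V := C_NormedModule) (- la)%C). apply Cmult_comm. now apply HG1.
      - intros t. assert (Hc : Cmod (circle r t) = r) by (apply Cmod_circle; lra).
        assert (Hd : in_disk (circle r t)) by (unfold in_disk; lra).
        specialize (Hu _ Hd). rewrite (HG _ Hd), Cmod_mult, Cmod_pow, Hc in Hu.
        assert (HGb : Cmod (la * G (circle r t)) <= / r ^ n).
        { rewrite Cmod_mult, Hla1. apply Rmult_le_reg_l with (r ^ n); auto. rewrite Rinv_r by lra. lra. }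
        assert (Hre := re_le_Cmod (la * G (circle r t))). apply Rabs_le_between in Hre. unfold Re in Hre. simpl in *. lra. }
    rewrite pow_add. apply (Rmult_le_compat_l (r ^ n)) in K'; [|lra].
    replace (r ^ n * (2 * (/ r ^ n - Cmod (A n)))) with (2 - 2 * Cmod (A n) * r ^ n) in K' by (field; lra). lra. }
  apply le_at_1 in Hr. lra.
Qed.

(** * Majorant series of derivatives *)

Lemma C_derive_expansion f A : has_expansion f A -> has_expansion (C_derive f) (ps_deriv A).
Proof.
  intros H z Hz. rewrite (cderiv_C_derive _ _ _ (pseries_cderiv A f 1 H z Hz)).
  now apply (ps_deriv_pseries A f 1).
Qed.

Lemma coeffs_eq f A n : has_expansion f A -> coeffs f n = A n.
Proof.
  intros H. apply (pseries_coeffs_unique _ _ f 1); auto. lra.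
  change (has_expansion f (coeffs f)). unfold coeffs. apply epsilon_spec. now exists A.
Qed.

Lemma majorant_C_derive f A r : has_expansion f A ->
  majorant_series (C_derive f) r = Series (fun n => INR (S n) * Cmod (A (S n)) * r ^ n).
Proof.
  intros H. apply Series_ext. intros n.
  rewrite (coeffs_eq _ _ n (C_derive_expansion _ _ H)). unfold ps_deriv.
  rewrite Cmod_mult, Cmod_R, Rabs_pos_eq by apply pos_INR. reflexivity.
Qed.

Lemma coeffs_expansion f : (forall z, in_disk z -> holo_at f z) -> has_expansion f (coeffs f).
Proof. intros H. unfold coeffs. apply epsilon_spec. now apply holo_on_disk_expansion. Qed.

Lemma sum_n_S_R (u : nat -> R) n : sum_n u (S n) = sum_n u n + u (S n).
Proof. exact (sum_Sn u n). Qed.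

Lemma sum_n_Rmult (c : R) (u : nat -> R) n : sum_n (fun k => c * u k) n = c * sum_n u n.
Proof. exact (sum_n_mult_l (K := R_Ring) c u n). Qed.

Lemma sum_n_le_loc (u v : nat -> R) N : (forall k, (k <= N)%nat -> u k <= v k) ->
  sum_n u N <= sum_n v N.
Proof.
  induction N as [|N IH]; intros H.
  - rewrite !sum_O. now apply H.
  - rewrite !sum_n_S_R. apply Rplus_le_compat; auto.
Qed.

Lemma r0_spec r : r <= r0 -> 2 / 3 <= (1 - r) ^ 2.
Proof.
  intros H. unfold r0 in H. assert (K := sqrt_sqrt (2 / 3) ltac:(lra)).
  assert (K0 := sqrt_pos (2 / 3)). nra.
Qed.

Lemma r0_lt_1 : r0 < 1.
Proof. unfold r0. assert (K := sqrt_lt_R0 (2 / 3) ltac:(lra)). lra. Qed.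

(** The series sums to [1 / (1 - r)^2], which is at most [3 / 2] exactly when
    [r <= r0]. *)
Lemma sum_arithmetic_geometric_le r J : 0 <= r <= r0 ->
  sum_n (fun j => INR (S j) * r ^ j) J <= 3 / 2.
Proof.
  intros Hr. assert (H := r0_spec r ltac:(lra)). assert (H1 := r0_lt_1).
  assert (E : (1 - r) ^ 2 * sum_n (fun j => INR (S j) * r ^ j) J
     = 1 - r ^ S J * (1 + INR (S J) * (1 - r))).
  { induction J as [|J IH].
    - rewrite sum_O. simpl. ring.
    - rewrite sum_n_S_R.
      rewrite Rmult_plus_distr_l, IH. rewrite (S_INR (S J)). simpl pow. ring. }
  assert (0 <= r ^ S J * (1 + INR (S J) * (1 - r))).
  { apply Rmult_le_pos. apply pow_le; lra. assert (K := pos_INR (S J)). nra. }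
  assert (0 <= sum_n (fun j => INR (S j) * r ^ j) J).
  { clear -Hr. induction J as [|J IH]. rewrite sum_O. simpl. lra.
    rewrite sum_n_S_R. apply Rplus_le_le_0_compat; auto. apply Rmult_le_pos. apply pos_INR. apply pow_le; lra. }
  nra.
Qed.

(** With [x = |A (m+1)|] the sum is at most
    [(m+1) r^m (x + 2 (1 - x) (1/(1-r)^2 - 1))], and the last factor is at most
    [1/2]. *)
Lemma derivative_sum_le (A : nat -> C) m r N : 0 <= r <= r0 ->
  (forall k, (k <= m)%nat -> A k = RtoC 0) ->
  (forall j, (0 < j)%nat -> Cmod (A (S m + j)%nat) <= 2 * (1 - Cmod (A (S m)))) ->
  sum_n (fun k => INR (S k) * Cmod (A (S k)) * r ^ k) N <= INR (S m) * r ^ m.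
Proof.
  intros Hr H0 Hj.
  assert (Hm : 0 <= INR (S m) * r ^ m) by (apply Rmult_le_pos; [apply pos_INR|apply pow_le; lra]).
  set (x := Cmod (A (S m))) in *.
  assert (Hx : 0 <= x) by apply Cmod_ge_0.
  assert (Hx1 : 0 <= 1 - x) by (specialize (Hj 1%nat ltac:(lia)); assert (K := Cmod_ge_0 (A (S m + 1)%nat)); lra).
  set (T := fun k => INR (S k) * Cmod (A (S k)) * r ^ k).
  assert (Hlow : forall n, (n < m)%nat -> sum_n T n = 0).
  { induction n as [|n IH]; intros Hn.
    - rewrite sum_O. unfold T. rewrite H0 by lia. rewrite Cmod_0. as_R. ring.
    - rewrite sum_n_S_R, IH by lia. unfold T. rewrite H0 by lia. rewrite Cmod_0. as_R. ring. }
  destruct (Nat.lt_ge_cases N m) as [h|h]. now rewrite Hlow.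
  assert (Hhigh : forall J, sum_n T (m + J) <=
     INR (S m) * r ^ m * (x + 2 * (1 - x) * (sum_n (fun j => INR (S j) * r ^ j) J - 1))).
  { induction J as [|J IH].
    - rewrite Nat.add_0_r, sum_O. apply Req_le.
      assert (E : sum_n T m = T m).
      { destruct m as [|p]. now rewrite sum_O. rewrite sum_n_S_R, Hlow by lia. as_R. ring. }
      rewrite E. unfold T. fold x. simpl (INR 1 * r ^ 0). ring.
    - rewrite Nat.add_succ_r, !sum_n_S_R.
      assert (K : T (S (m + J)) <= INR (S m) * r ^ m * (2 * (1 - x) * (INR (S (S J)) * r ^ S J))).
      { unfold T. specialize (Hj (S J) ltac:(lia)).
        replace (S m + S J)%nat with (S (S (m + J))) in Hj by lia.
        replace (r ^ S (m + J)) with (r ^ m * r ^ S J) by (rewrite <- pow_add; f_equal; lia).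
        assert (P1 : 0 <= r ^ m * r ^ S J) by (apply Rmult_le_pos; apply pow_le; lra).
        assert (P2 : INR (S (S (m + J))) <= INR (S m) * INR (S (S J))).
        { rewrite <- mult_INR. apply le_INR. nia. }
        assert (P3 := pos_INR (S (S (m + J)))).
        apply Rle_trans with (INR (S m) * INR (S (S J)) * (2 * (1 - x)) * (r ^ m * r ^ S J)).
        - apply Rmult_le_compat_r; auto. apply Rmult_le_compat; auto. apply Cmod_ge_0.
        - apply Req_le. ring. }
      eapply Rle_trans. apply Rplus_le_compat; [exact IH|exact K]. apply Req_le. ring. }
  replace N with (m + (N - m))%nat by lia. eapply Rle_trans. apply Hhigh.
  assert (S := sum_arithmetic_geometric_le r (N - m) Hr).
  rewrite <- (Rmult_1_r (INR (Datatypes.S m) * r ^ m)) at 2. apply Rmult_le_compat_l; auto.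
  nra.
Qed.

Definition O_pow (F : C -> C) (n : nat) : Prop :=
  exists M delta, 0 < delta /\ forall z, Cmod z < delta -> Cmod (F z) <= M * Cmod z ^ n.

(** [g] and the combination differ by a constant and a function that vanishes
    to the order [N + 2], so their coefficients of index [1] to [N + 1] are the
    same. *)
Lemma expansion_coeff_sum (g : C -> C) (b : nat -> C) (c : nat -> C) (v : nat -> C -> C) (al : nat -> nat -> C) N :
  has_expansion g b -> (forall n, has_expansion (v n) (al n)) ->
  O_pow (fun z => g z - g (RtoC 0) - sum_n (G := C_AbelianMonoid) (fun n => c n * v n z)%C N)%C (S (S N)) ->
  forall k, (k <= N)%nat -> b (S k) = sum_n (G := C_AbelianMonoid) (fun n => c n * al n (S k))%C N.
Proof.
  intros Hg Hv [M [d [Hd HO]]] k Hk.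
  assert (Hsum : forall n z, in_disk z -> is_pseries (fun k => sum_n (G := C_AbelianMonoid) (fun n => c n * al n k)%C n) z
      (sum_n (G := C_AbelianMonoid) (fun n => c n * v n z)%C n)).
  { intros n z Hz.
    assert (Hs : forall n, is_pseries (fun k => c n * al n k)%C z (c n * v n z)%C).
    { intros i. apply (is_pseries_scal (K := C_AbsRing) (V := C_NormedModule) (c i)). apply Cmult_comm. now apply Hv. }
    induction n as [|n IH].
    - rewrite sum_O. eapply is_pseries_ext. 2: apply Hs. intros i. now rewrite sum_O.
    - rewrite sum_Sn. eapply is_pseries_ext. 2: apply (is_pseries_plus (K := C_AbsRing) (V := C_NormedModule)); [exact IH|apply (Hs (S n))].
      intros i. now rewrite sum_Sn. }
  assert (E := coeffs_vanish (S (S N))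
    (PS_minus (K := C_AbsRing) (V := C_NormedModule) (PS_minus (K := C_AbsRing) (V := C_NormedModule) b (const_coeffs (g (RtoC 0))))
       (fun k => sum_n (G := C_AbelianMonoid) (fun n => c n * al n k)%C N))
    (fun z => g z - g (RtoC 0) - sum_n (G := C_AbelianMonoid) (fun n => c n * v n z)%C N)%C 1 M d ltac:(lra) Hd).
  specialize (E ltac:(intros z Hz; apply (is_pseries_minus (K := C_AbsRing) (V := C_NormedModule));
    [apply (is_pseries_minus (K := C_AbsRing) (V := C_NormedModule)); [now apply Hg|apply is_pseries_const]|now apply Hsum])).
  specialize (E ltac:(intros z Hz; apply HO; lra) (S k) ltac:(lia)).
  apply Ceq_minus. rewrite <- E.
  change (b (S k) - sum_n (G := C_AbelianMonoid) (fun n => c n * al n (S k))%C N =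
    b (S k) - 0 - sum_n (G := C_AbelianMonoid) (fun n => c n * al n (S k))%C N)%C.
  as_C. ring.
Qed.

Lemma O_pow_coeffs F A n k : has_expansion F A -> O_pow F n -> (k < n)%nat -> A k = RtoC 0.
Proof.
  intros HA [M [d [Hd H]]] Hk. apply (coeffs_vanish n A F 1 M d); auto. lra. intros z Hz. apply H. lra.
Qed.

(** Up to the index [N + 1] the coefficients of [g] are combinations of those of
    the [v n], so the partial sums of the majorant of [g'] are at most those of
    [sum_n |a_(n+1)|] times the majorant of [(v n)'], and each of these is at
    most [(n+1) r^n].  This is used with [v n = phi^(n+1)] and with
    [v n = z^(n+1) h]. *)
Lemma majorant_principle (f g : C -> C) (a : nat -> C) (v : nat -> C -> C) r :
  0 <= r <= r0 -> has_expansion f a -> (forall z, in_disk z -> holo_at g z) ->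
  (forall n z, in_disk z -> holo_at (v n) z) ->
  (forall n z, in_disk z -> Cmod (v n z) <= 1) ->
  (forall n, O_pow (v n) (S n)) ->
  (forall N, O_pow (fun z => g z - g (RtoC 0) - sum_n (G := C_AbelianMonoid) (fun n => a (S n) * v n z)%C N)%C (S (S N))) ->
  majorant_series (C_derive g) r <= majorant_series (C_derive f) r.
Proof.
  intros Hr Ha Hg Hv Hv1 HvO HO. assert (H1 := r0_lt_1).
  destruct (holo_on_disk_expansion g Hg) as [b Hb].
  set (al := fun n => coeffs (v n)).
  assert (Hal : forall n, has_expansion (v n) (al n)) by (intros n; apply coeffs_expansion, Hv).
  rewrite (majorant_C_derive g b), (majorant_C_derive f a) by auto.
  assert (Sf := pseries_abs_derive a f 1 Ha r ltac:(lra)).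
  assert (Sg := pseries_abs_derive b g 1 Hb r ltac:(lra)).
  refine (is_lim_seq_le _ _ (Series _) (Series _) _ (Series_correct _ Sg) (Series_correct _ Sf)).
  intros N.
  apply Rle_trans with (sum_n (fun n => Cmod (a (S n)) * sum_n (fun k => INR (S k) * Cmod (al n (S k)) * r ^ k) N) N).
  - apply Rle_trans with
      (sum_n (fun k => sum_n (fun n => Cmod (a (S n)) * (INR (S k) * Cmod (al n (S k)) * r ^ k)) N) N).
    2:{ rewrite (sum_n_switch (fun k n => Cmod (a (S n)) * (INR (S k) * Cmod (al n (S k)) * r ^ k))).
        apply Req_le, sum_n_ext. intros n. apply sum_n_Rmult. }
    apply sum_n_le_loc. intros k Hk.
    rewrite (sum_n_ext _ (fun n => (INR (S k) * r ^ k) * Cmod (a (S n) * al n (S k))%C)).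
    2:{ intros n. as_R. rewrite Cmod_mult. ring. }
    rewrite sum_n_Rmult.
    replace (INR (S k) * Cmod (b (S k)) * r ^ k) with ((INR (S k) * r ^ k) * Cmod (b (S k))) by ring.
    apply Rmult_le_compat_l; [apply Rmult_le_pos; [apply pos_INR|apply pow_le; lra]|].
    rewrite (expansion_coeff_sum g b (fun n => a (S n)) v al N Hb Hal (HO N) k Hk).
    apply Cmod_sum_n.
  - apply sum_n_m_le. intros n.
    rewrite (Rmult_comm (INR (S n))), Rmult_assoc. apply Rmult_le_compat_l. apply Cmod_ge_0.
    apply derivative_sum_le; auto.
    + intros k Hk. apply (O_pow_coeffs (v n) (al n) (S n)); auto. lia.
    + intros j Hj. apply (bounded_coeff (v n)); auto.
      intros k Hk. apply (O_pow_coeffs (v n) (al n) (S n)); auto.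
Qed.

(** * Subordinate and dominated functions *)

Lemma pow_S_le x n : 0 <= x <= 1 -> x ^ S n <= x.
Proof.
  intros H. apply Rle_trans with (x * 1); [|lra]. apply Rmult_le_compat_l. lra.
  assert (K := pow_incr x 1 n ltac:(lra)). now rewrite pow1 in K.
Qed.

(** Since [phi z = O(z)], the error of the Taylor polynomial of [f] at [phi z]
    is of the same order in [z]. *)
Lemma subordinate_majorant f g r : 0 <= r <= r0 ->
  (forall z, in_disk z -> holo_at f z) -> (forall z, in_disk z -> holo_at g z) -> subordinate g f ->
  majorant_series (C_derive g) r <= majorant_series (C_derive f) r.
Proof.
  intros Hr Hf Hg [phi [Hphi [Hphi0 [Hphi1 Hgf]]]].
  assert (Hph : forall z, in_disk z -> holo_at phi z) by (intros z Hz; apply analytic_at_holo; auto).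
  assert (Ha := coeffs_expansion f Hf). set (a := coeffs f) in *.
  assert (H0 : in_disk (RtoC 0)) by (unfold in_disk; rewrite Cmod_0; lra).
  assert (Hlin : exists M, 0 < M /\ forall z, Cmod z <= 1 / 2 -> Cmod (phi z) <= M * Cmod z).
  { destruct (pseries_tail (coeffs phi) phi 1 (1 / 2) 0 (coeffs_expansion phi Hph) ltac:(lra)) as [M HM].
    assert (E := is_pseries_at_0 _ _ (coeffs_expansion phi Hph _ H0)). rewrite Hphi0 in E.
    exists (Rabs M + 1). split. assert (K := Rabs_pos M); lra. intros z Hz. specialize (HM z Hz).
    rewrite sum_O, <- E, pow_1 in HM. replace (phi z - 0 * z ^ 0)%C with (phi z) in HM by ring.
    assert (K := Rle_abs M). assert (K' := Cmod_ge_0 z). nra. }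
  destruct Hlin as [M [HM0 HM]].
  assert (Hg0 : g (RtoC 0) = a 0%nat).
  { rewrite Hgf, Hphi0 by auto. apply is_pseries_at_0. now apply Ha. }
  apply (majorant_principle f g a (fun n z => phi z ^ S n)%C r Hr Ha Hg).
  - intros n z Hz. apply holo_at_pow. auto.
  - intros n z Hz. rewrite Cmod_pow. specialize (Hphi1 z Hz). assert (K := Cmod_ge_0 (phi z)).
    eapply Rle_trans. apply pow_S_le. lra. lra.
  - intros n. exists (M ^ S n), (1 / 2). split. lra. intros z Hz. rewrite Cmod_pow, <- Rpow_mult_distr.
    apply pow_incr. split. apply Cmod_ge_0. apply HM. lra.
  - intros N. destruct (pseries_tail a f 1 (1 / 2) (S N) Ha ltac:(lra)) as [M' HM'].
    exists (Rabs M' * M ^ S (S N)), (Rmin (1 / 2) (/ (2 * M))). split.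
    { apply Rmin_pos. lra. apply Rinv_0_lt_compat. lra. }
    intros z Hz. assert (z1 := Rmin_l (1 / 2) (/ (2 * M))). assert (z2 := Rmin_r (1 / 2) (/ (2 * M))).
    assert (Hz' : in_disk z) by (unfold in_disk; lra).
    specialize (HM z ltac:(lra)).
    assert (Hs : Cmod (phi z) <= 1 / 2).
    { eapply Rle_trans. exact HM. replace (1 / 2) with (M * / (2 * M)) by (field; lra).
      apply Rmult_le_compat_l; lra. }
    specialize (HM' _ Hs).
    rewrite Hgf, Hg0 by auto.
    replace (f (phi z) - a 0%nat - sum_n (G := C_AbelianMonoid) (fun n => a (S n) * phi z ^ S n)%C N)%C with
     (f (phi z) - sum_n (G := C_AbelianMonoid) (fun k => a k * phi z ^ k)%C (S N))%C.
    2:{ assert (E : forall n, sum_n (G := C_AbelianMonoid) (fun k => a k * phi z ^ k)%C (S n) =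
          (a 0%nat + sum_n (G := C_AbelianMonoid) (fun n => a (S n) * phi z ^ S n) n)%C).
        { induction n as [|n IH]. rewrite sum_Sn, !sum_O. unfold plus; simpl. as_C. ring.
          rewrite sum_Sn, IH, sum_Sn. unfold plus; simpl. as_C. ring. }
        rewrite E. ring. }
    eapply Rle_trans. exact HM'. rewrite Rmult_assoc, <- Rpow_mult_distr.
    assert (K : 0 <= Cmod (phi z) ^ S (S N) <= (M * Cmod z) ^ S (S N)).
    { split. apply pow_le, Cmod_ge_0. apply pow_incr. split; auto. apply Cmod_ge_0. }
    apply Rle_trans with (Rabs M' * Cmod (phi z) ^ S (S N)).
    apply Rmult_le_compat_r. apply K. apply Rle_abs. apply Rmult_le_compat_l. apply Rabs_pos. apply K.
Qed.

(** Near each point both functions have the factor [(z - z0)^m], [m] the order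
    of [f]; cancelling it leaves a quotient with nonvanishing denominator. *)
Lemma local_quotient (f g : C -> C) z0 rho : 0 < rho ->
  (forall w, Cmod (w - z0) < rho -> holo_at f w) -> (forall w, Cmod (w - z0) < rho -> holo_at g w) ->
  (forall w, Cmod (w - z0) < rho -> Cmod (g w) <= Cmod (f w)) ->
  ~ locally z0 (fun w => f w = RtoC 0) ->
  exists q delta, 0 < delta /\ forall w, Cmod (w - z0) < delta ->
    holo_at q w /\ g w = (f w * q w)%C /\ (w <> z0 -> f w <> RtoC 0).
Proof.
  intros Hr Hf Hg Hgf Hn.
  destruct (Taylor_ball f z0 rho Hr Hf) as [A HA]. destruct (Taylor_ball g z0 rho Hr Hg) as [B HB].
  assert (Hex : exists m, A m <> RtoC 0 /\ forall k, (k < m)%nat -> A k = RtoC 0).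
  { destruct (excluded_middle_informative (exists m, A m <> RtoC 0)) as [H|H].
    - destruct (dec_inh_nat_subset_has_unique_least_element (fun m => A m <> RtoC 0)) as [m [[h1 h2] _]]; auto.
      { intros n. destruct (Ceq_dec (A n) (RtoC 0)); [right|left]; tauto. }
      exists m. split; auto. intros k Hk. destruct (Ceq_dec (A k) (RtoC 0)) as [e|e]; auto.
      specialize (h2 k e). lia.
    - exfalso. apply Hn. apply locally_Cmod. exists rho. split; auto. intros w Hw.
      specialize (HA _ Hw). replace (z0 + (w - z0))%C with w in HA by ring.
      apply (proj1 (is_pseries_C _ _ _)) in HA. apply (is_series_C_unique _ _ _ HA).
      generalize (proj1 (is_pseries_C _ _ _) (is_pseries_const (RtoC 0) (w - z0)%C)).
      apply is_series_ext. intros n. replace (A n) with (RtoC 0). now destruct n.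
      destruct (Ceq_dec (A n) (RtoC 0)); auto. exfalso. eauto. }
  destruct Hex as [m [Hm HAm]].
  destruct (pseries_factor A _ rho m HA HAm) as [F [HF1 HF2]].
  assert (HBm : forall k, (k < m)%nat -> B k = RtoC 0).
  { destruct (pseries_bounded _ _ _ (rho / 2) HF1 ltac:(lra)) as [M HM].
    apply (coeffs_vanish m B (fun u => g (z0 + u)%C) rho M (rho / 2)); auto. lra.
    intros u Hu. eapply Rle_trans. apply Hgf. replace (z0 + u - z0)%C with u by ring. lra.
    rewrite (HF2 u) by lra. rewrite Cmod_mult, Cmod_pow, Rmult_comm. apply Rmult_le_compat_r.
    apply pow_le; lra. apply HM. lra. }
  destruct (pseries_factor B _ rho m HB HBm) as [G [HG1 HG2]].
  assert (HFh : forall u, Cmod u < rho -> holo_at F u).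
  { intros u Hu. apply (holo_at_pseries (fun n => A (m + n)%nat) F (RtoC 0) rho).
    intros v Hv. replace (v - 0)%C with v in * by ring. auto. now replace (u - 0)%C with u by ring. }
  assert (HGh : forall u, Cmod u < rho -> holo_at G u).
  { intros u Hu. apply (holo_at_pseries (fun n => B (m + n)%nat) G (RtoC 0) rho).
    intros v Hv. replace (v - 0)%C with v in * by ring. auto. now replace (u - 0)%C with u by ring. }
  assert (HF0 : F (RtoC 0) <> RtoC 0).
  { rewrite (is_pseries_at_0 _ _ (HF1 (RtoC 0) ltac:(rewrite Cmod_0; auto))). now rewrite Nat.add_0_r. }
  assert (Hnz := locally_neq_0 F (RtoC 0) (holo_at_continuous _ _ (HFh _ ltac:(rewrite Cmod_0; auto))) HF0).
  apply locally_Cmod in Hnz. destruct Hnz as [d [Hd Hnz]].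
  exists (fun w => G (- z0 + w) / F (- z0 + w))%C, (Rmin rho d). split. now apply Rmin_pos.
  intros w Hw. assert (w1 := Rmin_l rho d). assert (w2 := Rmin_r rho d).
  assert (Ew : (- z0 + w)%C = (w - z0)%C) by ring.
  assert (HFw : F (w - z0)%C <> RtoC 0).
  { apply Hnz. replace (w - z0 - 0)%C with (w - z0)%C by ring. lra. }
  assert (Ef := HF2 (w - z0)%C ltac:(lra)). assert (Eg := HG2 (w - z0)%C ltac:(lra)).
  replace (z0 + (w - z0))%C with w in Ef, Eg by ring.
  split; [|split].
  - apply holo_at_mult.
    + apply (holo_at_translate G). rewrite Ew. apply HGh. lra.
    + apply holo_at_inv. apply (holo_at_translate F). rewrite Ew. apply HFh. lra. now rewrite Ew.
  - rewrite Ew, Ef, Eg. field. auto.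
  - intros Hne. rewrite Ef. apply Cmult_neq_0; auto. apply Cpow_nz. now apply Cminus_eq_contra.
Qed.

Lemma punctured_exists (z : C) (P : C -> Prop) : locally z P -> exists w, w <> z /\ P w.
Proof.
  intros H. apply locally_Cmod in H. destruct H as [d [Hd H]].
  exists (z + RtoC (d / 2))%C. split.
  - intros E. assert (K : RtoC (d / 2) = RtoC 0).
    { replace (RtoC (d / 2)) with (z + RtoC (d / 2) - z)%C by ring. rewrite E. ring. }
    apply RtoC_inj in K. lra.
  - apply H. replace (z + RtoC (d / 2) - z)%C with (RtoC (d / 2)) by ring. rewrite Cmod_R, Rabs_pos_eq; lra.
Qed.

(** [h] is the limit of [g / f], which at each point is the value of a
    holomorphic local quotient.  The bound holds where [f] does not vanish, and
    at the isolated zeros of [f] by continuity. *)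
Lemma dominated_factor (f g : C -> C) :
  (forall z, in_disk z -> holo_at f z) -> (forall z, in_disk z -> holo_at g z) ->
  (forall z, in_disk z -> Cmod (g z) <= Cmod (f z)) ->
  exists h, (forall z, in_disk z -> holo_at h z) /\ (forall z, in_disk z -> Cmod (h z) <= 1) /\
    forall z, in_disk z -> g z = (f z * h z)%C.
Proof.
  intros Hf Hg Hgf.
  destruct (excluded_middle_informative (forall z, in_disk z -> f z = RtoC 0)) as [H0|H0].
  { exists (fun _ => RtoC 0). split; [|split].
    - intros; apply holo_at_const.
    - intros; rewrite Cmod_0; lra.
    - intros z Hz. rewrite (H0 z Hz), Cmult_0_l. apply Cmod_eq_0. specialize (Hgf z Hz). rewrite (H0 z Hz), Cmod_0 in Hgf.
      apply Rle_antisym. exact Hgf. apply Cmod_ge_0. }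
  assert (Hloc : forall z, in_disk z -> exists q delta, 0 < delta /\ forall w, Cmod (w - z) < delta ->
    holo_at q w /\ g w = (f w * q w)%C /\ (w <> z -> f w <> RtoC 0)).
  { intros z Hz. apply (local_quotient f g z (1 - Cmod z)).
    - unfold in_disk in Hz. lra.
    - intros w Hw. apply Hf. now apply disk_ball in Hw.
    - intros w Hw. apply Hg. now apply disk_ball in Hw.
    - intros w Hw. apply Hgf. now apply disk_ball in Hw.
    - intros K. apply H0. exact (identity_theorem f z Hf Hz K). }
  set (h := C_lim (fun w => g w / f w)%C).
  assert (Hh : forall z, in_disk z -> exists q, holo_at q z /\ locally z (fun w => h w = q w) /\ g z = (f z * q z)%C
     /\ locally z (fun w => w <> z -> f w <> RtoC 0)).
  { intros z Hz. destruct (Hloc z Hz) as [q [d [Hd Hq]]]. exists q.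
    assert (Hzz : Cmod (z - z) < d) by (replace (z - z)%C with (RtoC 0) by ring; now rewrite Cmod_0).
    split; [|split; [|split]]; try apply (Hq z Hzz).
    2:{ apply locally_Cmod. exists d. split; auto. intros w Hw. apply Hq. exact Hw. }
    apply locally_Cmod. exists d. split; auto. intros w Hw. apply is_C_lim_unique.
    apply filterlim_ext_loc with q.
    - unfold locally', within. apply locally_Cmod.
      (* Close to [w], points other than [w] also differ from the centre [z]. *)
      exists (if Ceq_dec w z then d - Cmod (w - z) else Rmin (d - Cmod (w - z)) (Cmod (w - z))).
      split.
      + destruct (Ceq_dec w z) as [e|e]. lra. apply Rmin_pos. lra. apply Cmod_gt_0. now apply Cminus_eq_contra.
      + intros v Hv Hne.
        assert (Hvd : Cmod (v - w) < d - Cmod (w - z) /\ v <> z).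
        { destruct (Ceq_dec w z) as [e|e]. split; auto. now rewrite <- e.
          split. eapply Rlt_le_trans. exact Hv. apply Rmin_l.
          intros ->. assert (K := Rlt_le_trans _ _ _ Hv (Rmin_r _ _)).
          replace (z - w)%C with (- (w - z))%C in K by ring. rewrite Cmod_opp in K. lra. }
        destruct (Hq v) as [_ [E Hz']].
        { replace (v - z)%C with ((v - w) + (w - z))%C by ring. eapply Rle_lt_trans. apply Cmod_triangle. lra. }
        rewrite E. as_C. field. apply Hz'. apply Hvd.
    - destruct (Hq w Hw) as [Hqh _]. apply holo_at_continuous in Hqh.
      intros P HP. specialize (Hqh P HP). unfold filtermap, locally', within in *.
      revert Hqh. apply filter_imp. auto. }
  assert (Hhh : forall z, in_disk z -> holo_at h z).
  { intros z Hz. destruct (Hh z Hz) as [q [h1 [h2 _]]]. apply holo_at_ext_loc with q; auto.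
    revert h2. apply filter_imp. auto. }
  assert (Hfh : forall z, in_disk z -> g z = (f z * h z)%C).
  { intros z Hz. destruct (Hh z Hz) as [q [h1 [h2 [h3 _]]]]. rewrite h3. f_equal.
    symmetry. exact (locally_singleton _ _ h2). }
  exists h. split; [|split]; auto.
  intros z Hz. destruct (Rle_lt_dec (Cmod (h z)) 1) as [K|K]; auto. exfalso.
  assert (Hc := continuous_Cmod h z (holo_at_continuous _ _ (Hhh z Hz))).
  specialize (Hc (fun y => 1 < y) (open_gt 1 _ K)). unfold filtermap in Hc.
  destruct (Hh z Hz) as [_ [_ [_ [_ Hnz]]]].
  assert (Hdisk : locally z in_disk).
  { apply locally_Cmod. exists (1 - Cmod z). split. unfold in_disk in Hz; lra. intros w Hw. now apply disk_ball in Hw. }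
  destruct (punctured_exists z _ (filter_and _ _ Hc (filter_and _ _ Hnz Hdisk))) as [w [Hwz [w1 [w2 w3]]]].
  specialize (Hgf w w3). rewrite (Hfh w w3), Cmod_mult in Hgf.
  assert (Hp := proj1 (Cmod_gt_0 _) (w2 Hwz)). nra.
Qed.

(** With [g = f h] and [h] bounded, the error of the Taylor polynomial of [f] is
    only multiplied by [h]. *)
Lemma dominated_majorant f g r : 0 <= r <= r0 ->
  (forall z, in_disk z -> holo_at f z) -> (forall z, in_disk z -> holo_at g z) -> dominated g f ->
  majorant_series (C_derive g) r <= majorant_series (C_derive f) r.
Proof.
  intros Hr Hf Hg [Hf0 Hgf].
  destruct (dominated_factor f g Hf Hg Hgf) as [h [Hh [Hh1 Hfh]]].
  assert (Ha := coeffs_expansion f Hf). set (a := coeffs f) in *.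
  assert (H0 : in_disk (RtoC 0)) by (unfold in_disk; rewrite Cmod_0; lra).
  assert (Ha0 : a 0%nat = RtoC 0) by (rewrite <- Hf0; symmetry; apply is_pseries_at_0; now apply Ha).
  assert (Hg0 : g (RtoC 0) = RtoC 0) by (rewrite Hfh, Hf0 by auto; ring).
  apply (majorant_principle f g a (fun n z => z ^ S n * h z)%C r Hr Ha Hg).
  - intros n z Hz. apply holo_at_mult; auto. apply holo_at_pow, holo_at_id.
  - intros n z Hz. rewrite Cmod_mult, Cmod_pow. specialize (Hh1 z Hz). assert (K := Cmod_ge_0 z). unfold in_disk in Hz.
    assert (L := pow_S_le (Cmod z) n ltac:(lra)). assert (L0 := pow_le (Cmod z) (S n) K).
    assert (K' := Cmod_ge_0 (h z)). nra.
  - intros n. exists 1, 1. split. lra. intros z Hz. specialize (Hh1 z Hz). rewrite Cmod_mult, Cmod_pow.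
    assert (L0 := pow_le (Cmod z) (S n) (Cmod_ge_0 z)). assert (K' := Cmod_ge_0 (h z)). nra.
  - intros N. destruct (pseries_tail a f 1 (1 / 2) (S N) Ha ltac:(lra)) as [M HM].
    exists M, (1 / 2). split. lra. intros z Hz. specialize (HM z ltac:(lra)).
    assert (Hz' : in_disk z) by (unfold in_disk; lra).
    replace (g z - g (RtoC 0) - sum_n (G := C_AbelianMonoid) (fun n => a (S n) * (z ^ S n * h z))%C N)%C with
      (h z * (f z - sum_n (G := C_AbelianMonoid) (fun k => a k * z ^ k)%C (S N)))%C.
    2:{ assert (E : forall n, (h z * sum_n (G := C_AbelianMonoid) (fun k => a k * z ^ k)%C (S n) =
          sum_n (G := C_AbelianMonoid) (fun n => a (S n) * (z ^ S n * h z)) n)%C).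
        { induction n as [|n IH]. rewrite sum_Sn, !sum_O, Ha0. unfold plus; simpl. as_C. ring.
          rewrite sum_Sn. transitivity (h z * sum_n (G := C_AbelianMonoid) (fun k => a k * z ^ k) (S n) + h z * (a (S (S n)) * z ^ S (S n)))%C.
          unfold plus; simpl; ring.
          rewrite IH, (sum_Sn _ n). unfold plus; simpl. as_C. ring. }
        rewrite <- E, Hg0, Hfh by auto. ring. }
    rewrite Cmod_mult. specialize (Hh1 z Hz').
    match goal with |- Cmod (h z) * ?x <= _ => assert (0 <= x) by apply Cmod_ge_0 end.
    assert (K' := Cmod_ge_0 (h z)). nra.
Qed.

(** * The extremal function *)

Lemma analytic_id : analytic_on_disk (fun z => z).
Proof. apply holo_on_disk_analytic. intros; apply holo_at_id. Qed.

Lemma majorant_derive_id r : 0 <= r < 1 -> majorant_series (C_derive (fun z => z)) r = 1.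
Proof.
  intros Hr. set (A := fun n => match n with O => RtoC 0 | S k => const_coeffs (RtoC 1) k end).
  assert (HA : has_expansion (fun z => z) A).
  { intros z Hz. assert (K := is_pseries_incr A z (RtoC 1) (is_pseries_const (RtoC 1) z)).
    replace (A 0%nat + z * 1)%C with z in K by (simpl; ring). exact K. }
  rewrite (majorant_C_derive _ _ _ HA), Series_incr_1 by (apply (pseries_abs_derive A _ 1 HA); lra).
  rewrite (Series_ext _ (fun _ => 0 * 0)), Series_scal_l.
  - simpl. rewrite Cmod_1. ring.
  - intros n. simpl. rewrite Cmod_0. ring.
Qed.

Lemma geometric_pseries (a z : C) : Cmod (a * z) < 1 -> is_pseries (fun n => (a ^ n)%C) z (/ (1 - a * z))%C.
Proof.
  intros H.
  destruct (ex_series_C_abs (fun n => a ^ n * z ^ n)%C) as [l Hl].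
  { apply (ex_series_ext (fun n => Cmod (a * z) ^ n)).
    intros n. as_R. now rewrite <- Cmod_pow, Cpow_mult_l.
    apply ex_series_geom. rewrite Rabs_pos_eq; auto. apply Cmod_ge_0. }
  apply (proj1 (is_pseries_C _ _ _)) in Hl.
  assert (K : is_pseries (fun n => (a ^ n)%C) z (1 + z * (a * l))%C).
  { apply (is_pseries_incr (fun n => (a ^ n)%C)).
    apply (is_pseries_scal (K := C_AbsRing) (V := C_NormedModule) a (fun n => (a ^ n)%C)). apply Cmult_comm. exact Hl. }
  assert (E : l = (1 + z * (a * l))%C).
  { apply (proj1 (is_pseries_C _ _ _)) in Hl. apply (proj1 (is_pseries_C _ _ _)) in K. exact (is_series_C_unique _ _ _ Hl K). }
  assert (Hn : (1 - a * z)%C <> RtoC 0).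
  { intros Z. replace (a * z)%C with (1 - (1 - a * z))%C in H by ring. rewrite Z in H.
    replace (1 - 0)%C with (RtoC 1) in H by ring. rewrite Cmod_1 in H. lra. }
  assert (E1 : (l * (1 - a * z))%C = RtoC 1).
  { replace (l * (1 - a * z))%C with (l - z * (a * l))%C by ring. rewrite E at 1. ring. }
  assert (El : (/ (1 - a * z))%C = l).
  { replace l with (l * (1 - a * z) / (1 - a * z))%C by (field; auto). rewrite E1. field. auto. }
  now rewrite El.
Qed.

(** [z] times the Blaschke factor with zero [a], the extremal function. *)
Definition extremal (a : R) (z : C) : C := (z * ((a - z) / (1 - a * z)))%C.

Definition extremal_coeffs (a : R) (n : nat) : C :=
  match n with
  | O => RtoC 0
  | 1%nat => RtoC a
  | S (S k) => (RtoC (- (1 - a ^ 2)) * RtoC a ^ k)%C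
  end.

Lemma Cmod_ar_lt_1 a z : 0 < a < 1 -> in_disk z -> Cmod (RtoC a * z) < 1.
Proof.
  intros Ha Hz. unfold in_disk in Hz. rewrite Cmod_mult, Cmod_R, Rabs_pos_eq by lra.
  assert (K := Cmod_ge_0 z). nra.
Qed.

Lemma denominator_neq_0 a z : 0 < a < 1 -> in_disk z -> (1 - RtoC a * z)%C <> RtoC 0.
Proof.
  intros Ha Hz Z. assert (H := Cmod_ar_lt_1 a z Ha Hz).
  replace (a * z)%C with (1 - (1 - a * z))%C in H by ring. rewrite Z in H.
  replace (1 - 0)%C with (RtoC 1) in H by ring. rewrite Cmod_1 in H. lra.
Qed.

Lemma extremal_expansion a : 0 < a < 1 -> has_expansion (extremal a) (extremal_coeffs a).
Proof.
  intros Ha z Hz. assert (G := geometric_pseries a z (Cmod_ar_lt_1 a z Ha Hz)).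
  apply (is_pseries_scal (K := C_AbsRing) (V := C_NormedModule) (RtoC (- (1 - a ^ 2)))) in G. 2: apply Cmult_comm.
  assert (K := is_pseries_incr (fun n => extremal_coeffs a (S n)) z _ G).
  apply (is_pseries_incr (extremal_coeffs a)) in K.
  match type of K with is_pseries _ _ ?l => replace l with (extremal a z) in K end. exact K.
  change (extremal a z = 0 + z * (a + z * (RtoC (- (1 - a ^ 2)) * / (1 - a * z))))%C.
  unfold extremal. rewrite RtoC_opp, RtoC_minus, RtoC_pow. field. now apply denominator_neq_0.
Qed.

Lemma Cmod_extremal_le a z : 0 < a < 1 -> in_disk z -> Cmod (extremal a z) <= Cmod z.
Proof.
  intros Ha Hz. assert (Hn := denominator_neq_0 a z Ha Hz). assert (Hp := proj1 (Cmod_gt_0 _) Hn).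
  unfold extremal. rewrite Cmod_mult, Cmod_div by auto.
  assert (Hz0 := Cmod_ge_0 z). unfold in_disk in Hz.
  assert (H : Cmod (a - z) <= Cmod (1 - a * z)).
  { assert (K : Cmod (1 - a * z) ^ 2 - Cmod (a - z) ^ 2 = (1 - a ^ 2) * (1 - Cmod z ^ 2)).
    { rewrite !Cmod2_alt. unfold Re, Im. simpl. ring. }
    assert (K' : 0 <= (1 - a ^ 2) * (1 - Cmod z ^ 2)) by (apply Rmult_le_pos; nra).
    apply Rsqr_incr_0. unfold Rsqr. nra. apply Cmod_ge_0. lra. }
  assert (H' : Cmod (a - z) / Cmod (1 - a * z) <= 1).
  { apply Rmult_le_reg_r with (Cmod (1 - a * z)); auto. unfold Rdiv. rewrite Rmult_assoc, Rinv_l; lra. }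
  rewrite <- (Rmult_1_r (Cmod z)) at 2. now apply Rmult_le_compat_l.
Qed.

Lemma extremal_analytic a : 0 < a < 1 -> analytic_on_disk (extremal a).
Proof.
  intros Ha. apply holo_on_disk_analytic. intros z Hz.
  apply (expansion_holo _ _ _ (extremal_expansion a Ha) Hz).
Qed.

(** The majorant series is summed by the functional equation of its tail [T]:
    [T = 2 c r + a r T + c r (a r) / (1 - a r)] with [c = 1 - a^2]. *)
Lemma majorant_derive_extremal a r : 0 < a < 1 -> 0 <= r < 1 ->
  majorant_series (C_derive (extremal a)) r = a + (1 - a ^ 2) * r * (2 - a * r) / (1 - a * r) ^ 2.
Proof.
  intros Ha Hr. assert (HA := extremal_expansion a Ha).
  assert (Hx : 0 <= a * r < 1) by nra.
  assert (Hc : 0 <= 1 - a ^ 2) by nra.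
  assert (Hex := pseries_abs_derive _ _ 1 HA r Hr).
  rewrite (majorant_C_derive _ _ _ HA), Series_incr_1 by exact Hex.
  set (t := fun n => (1 - a ^ 2) * r * (INR (S (S n)) * (a * r) ^ n)).
  assert (Et : forall n, INR (S (S n)) * Cmod (extremal_coeffs a (S (S n))) * r ^ S n = t n).
  { intros n. unfold t, extremal_coeffs. rewrite Cmod_mult, Cmod_pow, !Cmod_R, Rabs_Ropp, !Rabs_pos_eq by lra.
    rewrite Rpow_mult_distr. simpl pow. ring. }
  rewrite (Series_ext _ _ Et).
  assert (Ht : ex_series t).
  { apply (ex_series_ext _ _ Et). now apply (ex_series_incr_1 (fun n => INR (S n) * Cmod (extremal_coeffs a (S n)) * r ^ n)). }
  assert (Hg : ex_series (fun n => (a * r) ^ n)) by (apply ex_series_geom; rewrite Rabs_pos_eq; lra).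
  assert (E : Series t = (1 - a ^ 2) * r * 2 + (a * r * Series t + (1 - a ^ 2) * r * (a * r) * / (1 - a * r))).
  { rewrite (Series_incr_1 t) at 1 by auto. f_equal.
    - unfold t. simpl. ring.
    - rewrite <- (Series_geom (a * r)) by (rewrite Rabs_pos_eq; lra).
      rewrite <- !Series_scal_l, <- Series_plus.
      + apply Series_ext. intros n. unfold t. rewrite (S_INR (S (S n))). simpl pow. ring.
      + exact (ex_series_scal (V := R_NormedModule) (a * r) t Ht).
      + exact (ex_series_scal (V := R_NormedModule) ((1 - a ^ 2) * r * (a * r)) _ Hg). }
  f_equal.
  - simpl. rewrite Cmod_R, Rabs_pos_eq by lra. ring.
  - assert (E' : Series t * (1 - a * r) = (1 - a ^ 2) * r * 2 + (1 - a ^ 2) * r * (a * r) * / (1 - a * r)) by lra.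
    apply Rmult_eq_reg_r with (1 - a * r); [|lra]. rewrite E'. field. lra.
Qed.

Lemma r0_pos : 0 < r0.
Proof.
  unfold r0. assert (K := sqrt_sqrt (2 / 3) ltac:(lra)). assert (K0 := sqrt_pos (2 / 3)). nra.
Qed.

Lemma majorant_derive_extremal_gt_1 r : r0 < r < 1 ->
  exists a, 0 < a < 1 /\ 1 < majorant_series (C_derive (extremal a)) r.
Proof.
  intros Hr.
  assert (H0 := r0_pos).
  assert (H1 : (1 - r) ^ 2 < 2 / 3).
  { unfold r0 in Hr. assert (K := sqrt_sqrt (2 / 3) ltac:(lra)). assert (K0 := sqrt_pos (2 / 3)). nra. }
  (* With [d = 1 - a] the wanted inequality (1 + a) > (1 + 2 a) (1 - a r)^2
     holds up to an error of at most [10 d]. *)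
  set (d := (2 - 3 * (1 - r) ^ 2) / 20).
  assert (Hd : 0 < d) by (unfold d; lra).
  assert (Hd1 : d <= 1 / 10) by (unfold d; assert (K := pow2_ge_0 (1 - r)); lra).
  set (a := 1 - d). assert (Ha : 0 < a < 1) by (unfold a; lra).
  exists a. split; auto. rewrite majorant_derive_extremal by lra.
  assert (Hx : 0 < a * r < 1) by nra.
  assert (Hsq : (1 - a * r) ^ 2 <= (1 - r) ^ 2 + 3 * d).
  { replace (1 - a * r) with ((1 - r) + d * r) by (unfold a; ring).
    assert (0 <= d * r <= d) by nra. nra. }
  assert (Hs : (1 + 2 * a) * (1 - a * r) ^ 2 < 1 + a).
  { apply Rle_lt_trans with (3 * ((1 - r) ^ 2 + 3 * d)).
    apply Rmult_le_compat; try lra. apply pow2_ge_0. unfold a. unfold d in *. lra. }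
  assert (Hp : 0 < (1 - a * r) ^ 2) by (apply pow_lt; lra).
  assert (Hw : 1 - a < (1 - a ^ 2) * r * (2 - a * r) / (1 - a * r) ^ 2).
  { apply Rmult_lt_reg_r with ((1 - a * r) ^ 2); auto. unfold Rdiv. rewrite Rmult_assoc, Rinv_l, Rmult_1_r by lra.
    replace ((1 - a ^ 2) * r * (2 - a * r)) with ((1 - a) * ((1 + a) * (r * (2 - a * r)))) by ring.
    apply Rmult_lt_compat_l. lra.
    apply Rmult_lt_reg_l with a. lra.
    replace (a * ((1 + a) * (r * (2 - a * r)))) with ((1 + a) * (1 - (1 - a * r) ^ 2)) by ring. lra. }
  lra.
Qed.

Theorem theorem2 :
  (forall f g : C -> C, analytic_on_disk f -> analytic_on_disk g ->
     forall r : R, 0 <= r <= r0 ->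
       (subordinate g f ->
          majorant_series (C_derive g) r <= majorant_series (C_derive f) r) /\
       (dominated g f ->
          majorant_series (C_derive g) r <= majorant_series (C_derive f) r)) /\
  (forall r : R, r0 < r < 1 ->
     exists f g : C -> C,
       analytic_on_disk f /\ analytic_on_disk g /\ subordinate g f /\
       majorant_series (C_derive g) r > majorant_series (C_derive f) r) /\
  (forall r : R, r0 < r < 1 ->
     exists f g : C -> C,
       analytic_on_disk f /\ analytic_on_disk g /\ dominated g f /\
       majorant_series (C_derive g) r > majorant_series (C_derive f) r).
Proof.
  assert (Hsharp : forall r, r0 < r < 1 -> exists a, 0 < a < 1 /\
    majorant_series (C_derive (extremal a)) r > majorant_series (C_derive (fun z => z)) r).
  { intros r Hr. destruct (majorant_derive_extremal_gt_1 r Hr) as [a [Ha H]].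
    exists a. split; auto. rewrite majorant_derive_id; auto.
    assert (K := r0_pos). lra. }
  split; [|split].
  - intros f g Hf Hg r Hr.
    assert (Hf' : forall z, in_disk z -> holo_at f z) by (intros z Hz; apply analytic_at_holo; auto).
    assert (Hg' : forall z, in_disk z -> holo_at g z) by (intros z Hz; apply analytic_at_holo; auto).
    split; intros H.
    + now apply subordinate_majorant.
    + now apply dominated_majorant.
  - intros r Hr. destruct (Hsharp r Hr) as [a [Ha H]].
    exists (fun z => z), (extremal a).
    split; [apply analytic_id|split; [now apply extremal_analytic|split; auto]].
    exists (extremal a). split; [now apply extremal_analytic|split; [|split; auto]].
    + unfold extremal. ring.
    + intros z Hz. eapply Rle_lt_trans. now apply Cmod_extremal_le. exact Hz.
  - intros r Hr. destruct (Hsharp r Hr) as [a [Ha H]].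
    exists (fun z => z), (extremal a).
    split; [apply analytic_id|split; [now apply extremal_analytic|split; auto]].
    split; auto. intros z Hz. now apply Cmod_extremal_le.
Qed.
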